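(* Let $I(G)$ be the edge ideal of a bipartite graph $G$ without isolated vertices. Then $S/I(G)^{(2)}$ is Cohen-Macaulay if and only if $G$ is a disjoint union of edges (i.e. $I(G)$ is a complete intersection).
   Context: $k$ is a fixed field. Graphs are finite and simple (no loops, no multiple edges), $V(G)=[n]=\{1,\dots,n\}$ with $n\ge 1$, and $S=k[x_1,\dots,x_n]$. The edge ideal is $I(G)=(x_ix_j : ij\in E(G))\subseteq S$. $I(G)^{(2)}=\bigcap_F P_F^2$, where $F$ runs over the maximal independent sets of $G$ and $P_F=(x_j : j\notin F)S$. $G$ is bipartite if its vertex set can be partitioned into two subsets $X,Y$ such that every edge has one vertex in $X$ and one in $Y$. $G$ is a disjoint union of edges if every vertex has degree exactly $1$. *)

(* Defs.v *)
From HB Require Import structures.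
From mathcomp Require Import all_boot all_order all_algebra.
From mathcomp Require Import mpoly.

Set Implicit Arguments.
Unset Strict Implicit.
Unset Printing Implicit Defensive.

Import GRing.Theory.
Local Open Scope ring_scope.

(* Ideals of a commutative ring are represented by Prop-valued predicates, and
   properties of a quotient R/J are written as properties of J in R. *)
Section Ideals.
Variable R : comNzRingType.
Implicit Types (A I J P : R -> Prop) (s : seq R).

Definition ideal_gen A : R -> Prop := fun f =>
  exists t : seq (R * R),
    (forall u, u \in t -> A u.2) /\ f = \sum_(u <- t) u.1 * u.2.

Definition ideal_mul I J : R -> Prop :=
  ideal_gen (fun f => exists a b, [/\ I a, J b & f = a * b]).

Definition ideal_add_seq J s : R -> Prop :=
  ideal_gen (fun f => J f \/ f \in s).

Definition is_ideal I : Prop :=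
  [/\ I 0, forall a b, I a -> I b -> I (a + b) & forall a b, I b -> I (a * b)].

Definition prime_ideal P : Prop :=
  [/\ is_ideal P, ~ P 1 & forall a b, P (a * b) -> P a \/ P b].

Definition sub_ideal I J : Prop := forall f, I f -> J f.

(* Q 0 < Q 1 < ... < Q d are primes containing J, i.e. the preimages of a
   strict chain of primes of R/J; values of Q beyond d are irrelevant. *)
Definition prime_chain J (d : nat) (Q : nat -> R -> Prop) : Prop :=
  (forall i, (i <= d)%N -> prime_ideal (Q i) /\ sub_ideal J (Q i)) /\
  (forall i, (i < d)%N ->
     sub_ideal (Q i) (Q i.+1) /\ ~ sub_ideal (Q i.+1) (Q i)).

Definition quotient_krull_dim J (d : nat) : Prop :=
  (exists Q, prime_chain J d Q) /\
  (forall d' Q, prime_chain J d' Q -> (d' <= d)%N).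

Definition quotient_regular_seq J s : Prop :=
  (forall i, (i < size s)%N -> forall g,
     ideal_add_seq J (take i s) (s`_i * g) -> ideal_add_seq J (take i s) g) /\
  ~ ideal_add_seq J s 1.

(* grade (m, R/J) = d *)
Definition quotient_depth (m J : R -> Prop) (d : nat) : Prop :=
  (exists s, [/\ quotient_regular_seq J s, forall f, f \in s -> m f
                 & size s = d]) /\
  (forall s, quotient_regular_seq J s -> (forall f, f \in s -> m f) ->
     (size s <= d)%N).

End Ideals.

Section EdgeIdeals.
Variables (k : fieldType) (n : nat).

Definition var_ideal (A : {set 'I_n}) : {mpoly k[n]} -> Prop :=
  ideal_gen (fun f => exists2 j, j \in A & f = 'X_j).

(* Cohen-Macaulayness of a standard graded algebra S/J, for J a homogeneous
   ideal: the depth is taken with respect to the graded maximal ideal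
   (x_1, ..., x_n). *)
Definition graded_cohen_macaulay (J : {mpoly k[n]} -> Prop) : Prop :=
  exists d, quotient_depth (var_ideal [set: 'I_n]) J d /\ quotient_krull_dim J d.

Definition independent (e : rel 'I_n) (F : {set 'I_n}) : bool :=
  [forall i in F, forall j in F, ~~ e i j].

(* I(G)^(2): the intersection of the P_F^2, F a maximal independent set. *)
Definition second_symbolic_power (e : rel 'I_n) : {mpoly k[n]} -> Prop :=
  fun f => forall F : {set 'I_n}, maxset (independent e) F ->
    ideal_mul (var_ideal (~: F)) (var_ideal (~: F)) f.

End EdgeIdeals.

Arguments second_symbolic_power k {n} e _.

Definition bipartite (n : nat) (e : rel 'I_n) : Prop :=
  exists X Y : {set 'I_n},
    [/\ X :|: Y = [set: 'I_n], X :&: Y = set0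
      & forall i j, e i j -> (i \in X /\ j \in Y) \/ (i \in Y /\ j \in X)].

Definition degree (n : nat) (e : rel 'I_n) (i : 'I_n) : nat :=
  #|[set j | e i j]|.

Definition disjoint_union_of_edges (n : nat) (e : rel 'I_n) : Prop :=
  forall i, degree e i = 1%N.

(* Main.v *)
(** A regular sequence s_1, ..., s_d in the maximal ideal is quasi-regular modulo
    the homogeneous ideal J = I(G)^(2), so multiplication by P(s), P in
    k[T_1, ..., T_d], can be followed on initial terms. Hence, if d = dim S/J,
    then S/J is torsion-free over k[T] and, up to completion, satisfies (S_2)
    over k[T]. Torsion-freeness forces all maximal independent sets to have d
    elements. For an edge uv write J : x_u x_v as the intersection of
    A = cap_(F containing u) P_F and B = cap_(F containing v) P_F; by (S_2),
    S/(A + B) has dimension d - 1, that is, some independent H with d - 1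
    elements can be completed both by u and by v. In terms of Hall's condition
    this says that H cap X and (H cap X) + u are tight sets, and two edges at the
    same vertex contradict submodularity of the neighbourhood function.
    Conversely, for disjoint edges x_i y_i the forms x_i - y_i are a regular
    sequence, since every intermediate quotient is a monomial one. Dimension
    and depth are bounded above by counting monomials: more than d elements of
    S/J are algebraically dependent, which is impossible for elements cutting
    out a chain of primes or for a regular sequence. *)
Require Import Defs.
From mathcomp Require Import mpoly.
From mathcomp Require Import all_boot all_order all_algebra.
From mathcomp Require Import zify ring.
From Stdlib Require Import Classical.

Set Implicit Arguments.
Unset Strict Implicit.
Unset Printing Implicit Defensive.

Import Order.TTheory GRing.Theory.
Local Open Scope ring_scope.

(** * Ideals and supports of polynomials *)

Section Ideal.
Variable R : comNzRingType.
Implicit Types (A I J : R -> Prop) (s : seq R).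

Lemma ideal_genW A f : A f -> ideal_gen A f.
Proof.
move=> Af; exists [:: (1, f)]; split; last by rewrite big_seq1 mul1r.
by move=> u; rewrite inE => /eqP->.
Qed.

Lemma ideal_gen_ideal A : is_ideal (ideal_gen A).
Proof.
split.
- by exists [::]; split; rewrite ?big_nil.
- move=> a b [ta [Ha ->]] [tb [Hb ->]]; exists (ta ++ tb); split.
    by move=> u; rewrite mem_cat => /orP[/Ha|/Hb].
  by rewrite big_cat.
- move=> a b [t [Ht ->]]; exists [seq (a * u.1, u.2) | u <- t]; split.
    by move=> u /mapP[v /Ht Av ->].
  by rewrite big_map mulr_sumr; apply: eq_bigr => u _; rewrite mulrA.
Qed.

Lemma ideal_sum I (T : eqType) (r : seq T) (P : pred T) (F : T -> R) :
  is_ideal I -> (forall t, t \in r -> P t -> I (F t)) ->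
  I (\sum_(t <- r | P t) F t).
Proof.
move=> [I0 ID _] HF; rewrite big_seq_cond; apply: (big_ind I) => //.
by move=> t /andP[]; apply: HF.
Qed.

Lemma ideal_gen_min A I :
  is_ideal I -> (forall f, A f -> I f) -> forall f, ideal_gen A f -> I f.
Proof.
move=> HI HA f [t [Ht ->]]; apply: ideal_sum => // u ut _.
by case: HI => _ _; apply; apply/HA/Ht.
Qed.

Lemma is_idealN I a : is_ideal I -> I a -> I (- a).
Proof. by case=> _ _ HM Ia; rewrite -mulN1r; apply: HM. Qed.

Lemma is_idealB I a b : is_ideal I -> I a -> I b -> I (a - b).
Proof. by move=> HI Ia Ib; case: (HI) => _ HD _; apply: HD => //; apply: is_idealN. Qed.

Lemma is_idealMr I a b : is_ideal I -> I a -> I (a * b).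
Proof. by case=> _ _ HM Ia; rewrite mulrC; apply: HM. Qed.

Lemma is_ideal_addKr I a b : is_ideal I -> I b -> I (a + b) -> I a.
Proof. by move=> HI Ib Iab; rewrite -(addrK b a); apply: is_idealB. Qed.

Lemma ideal_add_seq_ideal J s : is_ideal (ideal_add_seq J s).
Proof. exact: ideal_gen_ideal. Qed.

Lemma ideal_add_seqW J s f : J f -> ideal_add_seq J s f.
Proof. by move=> Jf; apply: ideal_genW; left. Qed.

Lemma ideal_add_seq_mem J s f : f \in s -> ideal_add_seq J s f.
Proof. by move=> fs; apply: ideal_genW; right. Qed.

Lemma ideal_add_seq_mono J s s' f :
  {subset s <= s'} -> ideal_add_seq J s f -> ideal_add_seq J s' f.
Proof.
move=> ss'; apply: ideal_gen_min; first exact: ideal_add_seq_ideal.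
by move=> g [/ideal_add_seqW|/ss' /ideal_add_seq_mem].
Qed.

Lemma ideal_cap_ideal (T : Type) (P : T -> Prop) (F : T -> R -> Prop) :
  (forall t, P t -> is_ideal (F t)) ->
  is_ideal (fun f => forall t, P t -> F t f).
Proof.
move=> HF; split=> [t /HF[]//|a b Ha Hb t Pt|a b Hb t Pt].
  by have [_ HD _] := HF t Pt; apply: HD; [apply: Ha|apply: Hb].
by have [_ _ HM] := HF t Pt; apply: HM; apply: Hb.
Qed.

End Ideal.

Section Supports.
Variables (R : comNzRingType) (d : nat).
Implicit Types (p q C : {mpoly R[d]}) (m u : 'X_{1..d}) (a b : pred 'X_{1..d}).

Definition supp_in a p := forall m, m \in msupp p -> a m.

Lemma supp_inP a p : supp_in a p <-> forall m, ~~ a m -> p@_m = 0.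
Proof.
split=> [H m am|H m]; last first.
  by rewrite mcoeff_msupp; apply: contraNT => /H ->; rewrite eqxx.
by apply: memN_msupp_eq0; apply: contra am; apply: H.
Qed.

Lemma supp_in_sub a b p : (forall m, a m -> b m) -> supp_in a p -> supp_in b p.
Proof. by move=> ab ap m /ap /ab. Qed.

Lemma supp_in0 a : supp_in a 0.
Proof. by move=> m; rewrite msupp0. Qed.

Lemma supp_inD a p q : supp_in a p -> supp_in a q -> supp_in a (p + q).
Proof.
move=> /supp_inP ap /supp_inP aq; apply/supp_inP => m am.
by rewrite mcoeffD ap ?aq ?addr0.
Qed.

Lemma supp_inN a p : supp_in a p -> supp_in a (- p).
Proof.
by move=> /supp_inP ap; apply/supp_inP => m am; rewrite mcoeffN ap ?oppr0.
Qed.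

Lemma supp_inB a p q : supp_in a p -> supp_in a q -> supp_in a (p - q).
Proof. by move=> ap aq; apply: supp_inD => //; apply: supp_inN. Qed.

Lemma supp_inM a b (c : pred 'X_{1..d}) p q :
  (forall m m', a m -> b m' -> c (m + m')%MM) ->
  supp_in a p -> supp_in b q -> supp_in c (p * q).
Proof.
move=> abc ap bq m /msuppM_le /allpairsP[[m1 m2] /= [H1 H2 ->]].
by apply: abc; [apply: ap|apply: bq].
Qed.

Lemma supp_in_sum a (T : eqType) (r : seq T) (P : pred T) (F : T -> {mpoly R[d]}) :
  (forall t, t \in r -> P t -> supp_in a (F t)) -> supp_in a (\sum_(t <- r | P t) F t).
Proof.
move=> H; rewrite big_seq_cond; apply: (big_ind (supp_in a)).
- exact: supp_in0.
- by move=> p q; apply: supp_inD.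
- by move=> t /andP[]; apply: H.
Qed.

Lemma supp_inZX a c m : a m -> supp_in a (c *: 'X_[m]).
Proof. by move=> am m' /msuppZ_le; rewrite msuppX inE => /eqP ->. Qed.

Lemma supp_inX a m : a m -> supp_in a 'X_[m].
Proof. by move=> am; rewrite -[X in supp_in _ X]scale1r; apply: supp_inZX. Qed.

Definition msel a p := \sum_(m <- msupp p | a m) p@_m *: 'X_[m].

Lemma mcoeff_msel a p m : (msel a p)@_m = if a m then p@_m else 0.
Proof.
rewrite /msel raddf_sum /= big_mkcond /=.
rewrite (eq_bigr (fun m' => if m' == m then (if a m then p@_m else 0) else 0)); last first.
  move=> m' _; case: eqP => [->|/eqP ne].
    by case: (a m) => //; rewrite mcoeffZ mcoeffX eqxx mulr1.
  by case: (a m') => //; rewrite mcoeffZ mcoeffX (negPf ne) mulr0.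
rewrite -big_mkcond /=; case: (boolP (m \in msupp p)) => mp.
  by rewrite -big_filter filter_pred1_uniq ?msupp_uniq // big_seq1.
rewrite big_seq_cond big_pred0 => [|m']; last first.
  by apply/negbTE; apply: contra mp => /andP[mp /eqP <-].
by rewrite (memN_msupp_eq0 mp) if_same.
Qed.

Definition mdivX u p := \sum_(m <- msupp p | (u <= m)%MM) p@_m *: 'X_[(m - u)].

Lemma mdivXE u p : p = msel (fun m => ~~ (u <= m)%MM) p + 'X_[u] * mdivX u p.
Proof.
rewrite {1}[p]mpolyE (bigID (fun m => (u <= m)%MM)) /= addrC; congr (_ + _).
rewrite /mdivX mulr_sumr; apply: eq_bigr => m um.
by rewrite -scalerAr -mpolyXD addmC submK.
Qed.

Lemma mcoeff_mdivX u p m : (mdivX u p)@_m = p@_(u + m).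
Proof.
have /(congr1 (mcoeff (u + m))) := mdivXE u p.
rewrite mcoeffD mcoeff_msel lem_addr /= add0r => ->.
by rewrite mulrC mcoeffMX.
Qed.

(** Only the pair (m1, m2) of the convolution survives modulo I. An arbitrary ideal is allowed so
    that initial terms can be multiplied both over S modulo an ideal and, with I zero, over the
    field. *)
Lemma mcoeffM_mod (I : R -> Prop) p q m1 m2 : is_ideal I ->
  (forall n1 n2, (n1 + n2 = m1 + m2)%MM -> n1 != m1 -> I (p@_n1 * q@_n2)) ->
  I ((p * q)@_(m1 + m2) - p@_m1 * q@_m2).
Proof.
move=> HI H; rewrite mcoeffM.
have lt1 : (mdeg m1 < (mdeg (m1 + m2)).+1)%N by rewrite mdegD ltnS leq_addr.
have lt2 : (mdeg m2 < (mdeg (m1 + m2)).+1)%N by rewrite mdegD ltnS leq_addl.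
rewrite (bigD1 (BMultinom lt1, BMultinom lt2)) //= addrC addrK.
apply: ideal_sum => // -[n1 n2] _ /= /andP[/eqP e ne].
apply: H; first by [].
apply: contra ne => /eqP e1; apply/eqP; congr pair; apply: val_inj => //=.
by apply: (@addmI _ m1); rewrite [RHS]e e1.
Qed.

End Supports.

Arguments supp_in {R d} a p.

Lemma mlast_min (R : nzRingType) d (p : {mpoly R[d]}) :
  p != 0 -> p@_(mlast p) != 0 /\ forall m, (m < mlast p)%O -> p@_m = 0.
Proof.
move=> p0; split; first by rewrite -mcoeff_msupp mlast_supp.
by move=> m; apply: mcoeff_lt_mlast.
Qed.

(** Membership in an ideal is an arbitrary proposition here, so the minimum comes from well-founded
    induction on the monomial order with a classical case distinction. *)
Lemma ex_min_mnm d (Q : 'X_{1..d} -> Prop) m :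
  Q m -> exists2 m0, Q m0 & forall m', (m' < m0)%O -> ~ Q m'.
Proof.
elim/(well_founded_ind (@ltom_wf d)): m => m IH Qm.
case: (classic (exists2 m', (m' < m)%O & Q m')) => [[m' lt Qm']|H].
  exact: IH lt Qm'.
by exists m => // m' lt Qm'; apply: H; exists m'.
Qed.

Lemma mnm_lt_split d (n1 n2 m1 m2 : 'X_{1..d}) :
  (n1 + n2 = m1 + m2)%MM -> n1 != m1 -> (n1 < m1)%O \/ (n2 < m2)%O.
Proof.
move=> e; rewrite neq_lt => /orP[|lt]; first by left.
right; rewrite ltNge; apply/negP => le.
by have := ltmc_le_add lt le; rewrite -e ltxx.
Qed.

(** * Quasi-regularity of regular sequences *)

Section QuasiRegular.
Variables (R : comNzRingType) (d : nat) (J : R -> Prop) (s : seq R).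
Hypothesis J_ideal : is_ideal J.
Hypothesis size_s : size s = d.
Hypothesis s_reg : forall i, (i < size s)%N -> forall g,
  ideal_add_seq J (take i s) (s`_i * g) -> ideal_add_seq J (take i s) g.
Implicit Types (C : {mpoly R[d]}) (m : 'X_{1..d}).

Let x (i : 'I_d) := s`_i.
Let Jr r := ideal_add_seq J (take r s).

Definition deg_ge_vars (N r : nat) : pred 'X_{1..d} :=
  fun m => (N <= mdeg m)%N && [forall i : 'I_d, (r <= i)%N ==> (m i == 0%N)].

(** This is the ideal J + (s_0, ..., s_(r-1))^N. *)
Definition power_add (r N : nat) (g : R) : Prop :=
  exists C, supp_in (deg_ge_vars N r) C /\ J (g - C.@[x]).

Let Jr_mono r r' f : (r <= r')%N -> Jr r f -> Jr r' f.
Proof.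
move=> le; apply: ideal_add_seq_mono => y.
by rewrite -(subnKC le) takeD mem_cat => ->.
Qed.

Let Jr_x r (i : 'I_d) : (i < r)%N -> Jr r (x i).
Proof.
move=> ir; apply: ideal_add_seq_mem; rewrite /x -(nth_take 0 ir).
by apply: mem_nth; rewrite size_take_min leq_min ir size_s ltn_ord.
Qed.

Lemma power_add_ideal r N : is_ideal (power_add r N).
Proof.
have [J0 JD JM] := J_ideal; split.
- by exists 0; split; [apply: supp_in0|rewrite meval0 subr0].
- move=> a b [C [HC Ja]] [D [HD Jb]]; exists (C + D); split; first exact: supp_inD.
  by rewrite mevalD opprD addrACA; apply: JD.
- move=> a b [C [HC Ja]]; exists (a *: C); split; last first.
    by rewrite mevalZ -mulrBr; apply: JM.
  by move=> m /msuppZ_le /HC.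
Qed.

Lemma power_addW r N g : J g -> power_add r N g.
Proof. by move=> Jg; exists 0; split; [apply: supp_in0|rewrite meval0 subr0]. Qed.

Lemma power_add_eval r N C : supp_in (deg_ge_vars N r) C -> power_add r N C.@[x].
Proof. by move=> HC; exists C; split=> //; rewrite subrr; case: J_ideal. Qed.

Lemma deg_ge_vars_sub N N' r r' m :
  (N' <= N)%N -> (r <= r')%N -> deg_ge_vars N r m -> deg_ge_vars N' r' m.
Proof.
move=> HN Hr /andP[dm /forallP vm]; apply/andP; split; first exact: leq_trans dm.
apply/forallP => i; apply/implyP => ri.
by apply: (implyP (vm i)); apply: leq_trans ri.
Qed.

(** A coefficient in J + (s_0, ..., s_(r-1)) is, modulo J, a combination of the s_i, and each s_i
    raises the degree of its term from N to N + 1. *)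
Lemma power_add_eval_next r N C : supp_in (deg_ge_vars N r) C ->
  (forall m, mdeg m = N -> Jr r C@_m) -> power_add r N.+1 C.@[x].
Proof.
move=> HC HJ; have PI := power_add_ideal r N.+1.
rewrite {1}[C]mpolyE raddf_sum /=; apply: ideal_sum => // m mC _.
have lm := HC m mC; rewrite mevalZ.
case: (ltngtP N (mdeg m)) => [lt|gt|e].
- rewrite -mevalZ; apply: power_add_eval; apply: supp_inZX.
  by case/andP: lm => _ v; rewrite /deg_ge_vars lt.
- by move: lm; rewrite /deg_ge_vars leqNgt gt.
have [P0 PD PM] := PI.
(* The admissible coefficients of the monomial m form an ideal, so only generators need to be
   tested. *)
have HI : is_ideal (fun c => power_add r N.+1 (c * ('X_[m]).@[x])).
  split=> [|a b Ha Hb|a b Hb]; first by rewrite mul0r.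
    by rewrite mulrDl; apply: PD.
  by rewrite -mulrA; apply: PM.
apply: (ideal_gen_min HI _ (HJ m (esym e))) => c [Jc|].
  by apply: power_addW; apply: is_idealMr.
move=> /(nthP 0)[i]; rewrite size_take_min leq_min size_s => /andP[ir id].
rewrite nth_take // => <-.
have -> : s`_i * ('X_[m]).@[x] = ('X_[U_(Ordinal id) + m]).@[x].
  by rewrite mpolyXD mevalM mevalXU.
apply/power_add_eval/supp_inX.
case/andP: lm => _ /forallP v; apply/andP; split; first by rewrite mdegD mdeg1 -e.
apply/forallP => j; apply/implyP => rj; rewrite mnmDE (eqP (implyP (v j) rj)).
by rewrite mnm1E addn0 eqb0 -val_eqE /=; lia.
Qed.

Definition quasi_regular r := forall N C, supp_in (deg_ge_vars N r) C -> J C.@[x] ->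
  forall m, mdeg m = N -> Jr r C@_m.

(** By induction g is C(s) modulo J with C of degree at least N. Since s_r C - D vanishes at s
    modulo J and D starts in degree N + 1, quasi-regularity puts s_r times the degree N coefficients
    of C into J + (s_0, ..., s_(r-1)). Regularity cancels s_r, and C(s) moves to the next power. *)
Lemma power_add_colon r (rd : (r < d)%N) : quasi_regular r ->
  forall N g, power_add r N (s`_r * g) -> power_add r N g.
Proof.
move=> QR; elim=> [|N IH] g [D [HD HJ]].
  exists g%:MP; split; last by rewrite mevalC subrr; case: J_ideal.
  move=> m; rewrite msuppC; case: ifP => // _; rewrite inE => /eqP ->.
  by apply/andP; split=> //; apply/forallP => i; rewrite mnm0E eqxx implybT.
have [|C [HC HJC]] := IH g.
  exists D; split=> //; move=> m /HD; exact: deg_ge_vars_sub.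
have -> : g = (g - C.@[x]) + C.@[x] by rewrite subrK.
have [_ PD _] := power_add_ideal r N.+1.
apply: PD; first exact: power_addW.
apply: power_add_eval_next => // m mN.
apply: (s_reg (i := r)); rewrite ?size_s //.
have -> : s`_r * C@_m = (s`_r *: C - D)@_m.
  rewrite mcoeffB mcoeffZ [D@_m](_ : _ = 0) ?subr0 //.
  by move/supp_inP: HD; apply; rewrite /deg_ge_vars mN ltnn.
apply: QR mN.
  apply: supp_inB => [k /msuppZ_le /HC //|k /HD].
  exact: deg_ge_vars_sub.
rewrite mevalB mevalZ.
have -> : s`_r * C.@[x] - D.@[x] = (s`_r * g - D.@[x]) - s`_r * (g - C.@[x]).
  by ring.
by apply: is_idealB => //; case: J_ideal => _ _; apply.
Qed.

(** Write C = G + T_r H with G free of T_r. The coefficients of H are handled by induction on the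
    degree, those of G by quasi-regularity for r, after H(s) has been rewritten in the first r
    elements. *)
Lemma quasi_regularS r : (r < d)%N -> quasi_regular r -> quasi_regular r.+1.
Proof.
move=> rd QR; pose t := Ordinal rd; elim=> [|N IH] C HC HJ m mN.
  have /eqP m0 : m == 0%MM by rewrite -mdeg_eq0 mN.
  have : Jr r.+1 (C.@[x] - (C - C@_m *: 'X_[m]).@[x]).
    apply: is_idealB; first exact: ideal_add_seq_ideal.
      exact: ideal_add_seqW.
    rewrite [C - _]mpolyE raddf_sum /=; apply: ideal_sum; first exact: ideal_add_seq_ideal.
    move=> k kC _; rewrite mevalZ; case: (ideal_add_seq_ideal J (take r.+1 s)) => _ _; apply.
    case: (boolP (deg_ge_vars 0 r.+1 k)) => lk; last first.
      have := kC; rewrite mcoeff_msupp mcoeffB mcoeffZ mcoeffX.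
      move/supp_inP: (HC) => /(_ _ lk) ->; suff /negPf -> : m != k.
        by rewrite mulr0 subr0 eqxx.
      apply: contra lk => /eqP <-; rewrite m0; apply/andP; split=> //.
      by apply/forallP => i; rewrite mnm0E eqxx implybT.
    have : k != 0%MM.
      apply: contraL kC => /eqP ->.
      by rewrite mcoeff_msupp mcoeffB mcoeffZ m0 mcoeffX eqxx mulr1 subrr eqxx.
    rewrite -mdeg_eq0 mdegE sum_nat_eq0 negb_forall => /existsP[i /= ki].
    have ir : (i < r.+1)%N.
      by rewrite ltnNge; apply: contra ki; case/andP: lk => _ /forallP/(_ i)/implyP.
    rewrite mevalX (bigD1 i) //= mulrC -(prednK (n := k i)) ?lt0n // exprS mulrCA.
    by apply: is_idealMr; [exact: ideal_add_seq_ideal|exact: Jr_x].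
  by rewrite mevalB opprB addrC subrK mevalZ m0 mpolyX0 meval1 mulr1.
set H := mdivX U_(t) C; set G := msel (fun k => ~~ (U_(t) <= k)%MM) C.
have CE : C = G + 'X_t * H := mdivXE _ _.
have HG : supp_in (deg_ge_vars N.+1 r) G.
  apply/supp_inP => k lk; rewrite mcoeff_msel; case: ifP => // kt.
  move/supp_inP: HC; apply; apply: contra lk => /andP[kN /forallP kv].
  rewrite /deg_ge_vars kN; apply/forallP => i; apply/implyP; rewrite leq_eqVlt => /orP[/eqP ri|ri].
    by move: kt; rewrite lep1mP negbK (_ : i = t) //; apply: val_inj.
  exact: (implyP (kv i)).
have HH : supp_in (deg_ge_vars N r.+1) H.
  apply/supp_inP => k lk; rewrite mcoeff_mdivX.
  move/supp_inP: HC; apply; apply: contra lk => /andP[kN /forallP kv]; apply/andP; split.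
    by move: kN; rewrite mdegD mdeg1 add1n ltnS.
  apply/forallP => i; apply/implyP => ri; move/implyP: (kv i) => /(_ ri).
  by rewrite mnmDE addn_eq0 => /andP[].
have xt : x t = s`_r by [].
have CEx : C.@[x] = G.@[x] + s`_r * H.@[x] by rewrite CE mevalD mevalM mevalXU.
have [_ PD _] := power_add_ideal r N.+1.
(* Modulo J, s_r H(s) equals - G(s). Hence H(s) equals E(s) with E of degree at least N + 1 in the
   first r variables, so H - E and H have the same coefficients in degree N. *)
have [|E [HE JE]] := power_add_colon rd QR (N := N.+1) (g := H.@[x]).
  have -> : s`_r * H.@[x] = C.@[x] - G.@[x] by rewrite CEx addrC addKr.
  apply: is_idealB; first exact: power_add_ideal.
    exact: power_addW.
  exact: power_add_eval.
have JH k : mdeg k = N -> Jr r.+1 H@_k.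
  move=> kN; have -> : H@_k = (H - E)@_k.
    rewrite mcoeffB [E@_k](_ : _ = 0) ?subr0 //.
    by move/supp_inP: HE; apply; rewrite /deg_ge_vars kN ltnn.
  apply: IH kN; last by rewrite mevalB.
  by apply: supp_inB => // k' /HE; apply: deg_ge_vars_sub.
case: (boolP (U_(t) <= m)%MM) => tm.
  rewrite -(submK tm) addmC -mcoeff_mdivX; apply: JH.
  by move: mN; rewrite -{1}(submK tm) mdegD mdeg1 addn1 => -[].
have -> : C@_m = G@_m by rewrite mcoeff_msel tm.
have /(Jr_mono (leqnSn r)) : Jr r (G + s`_r *: E)@_m.
  apply: QR mN.
    by apply: supp_inD => // k /msuppZ_le /HE.
  have -> : (G + s`_r *: E).@[x] = C.@[x] - s`_r * (H.@[x] - E.@[x]).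
    by rewrite mevalD mevalZ CEx; ring.
  by apply: is_idealB => //; case: J_ideal => _ _; apply.
rewrite mcoeffD mcoeffZ; apply: is_ideal_addKr; first exact: ideal_add_seq_ideal.
apply: is_idealMr; first exact: ideal_add_seq_ideal.
exact: (@Jr_x _ t).
Qed.

Lemma regular_quasi_regular r : (r <= d)%N -> quasi_regular r.
Proof.
elim: r => [_ N C HC HJ m mN|r IH rd]; last by apply: quasi_regularS => //; apply/IH/ltnW.
have CC : C = (C@_0%MM)%:MP.
  apply/mpolyP => k; rewrite mcoeffC; case: eqP => [->|/eqP k0]; first by rewrite mulr1.
  rewrite mulr0; move/supp_inP: HC; apply; apply: contra k0 => /andP[_ /forallP kv].
  by rewrite -mdeg_eq0 mdegE sum_nat_eq0; apply/forallP => i; have := kv i.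
rewrite CC mevalC in HJ; rewrite CC mcoeffC.
by apply: ideal_add_seqW; apply: is_idealMr.
Qed.

End QuasiRegular.

(** * Lexicographic initial terms and algebraic dependence *)

Section LexInitial.
Variables (R : comNzRingType) (d : nat) (J : nat -> R -> Prop) (x : 'I_d -> R).
Hypothesis J_ideal : forall r, (r <= d)%N -> is_ideal (J r).
Hypothesis J_sub : forall (i : 'I_d) g, J i g -> J i.+1 g.
Hypothesis J_x : forall i : 'I_d, J i.+1 (x i).
Hypothesis J_reg : forall (i : 'I_d) g, J i (x i * g) -> J i g.

(* The coefficient found is that of the lexicographically smallest monomial:
   powers of x_i cancel modulo J_i and x_i vanishes modulo J_{i+1}. *)
Lemma lex_initial (C : {mpoly R[d]}) :
  C != 0 -> J 0 C.@[x] -> exists2 m, m \in msupp C & J d C@_m.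
Proof.
move=> C0 JC.
(* D collects the terms of C whose exponents in the first r variables are lexicographically
   smallest, with these variables divided out. *)
suff /(_ d (leqnn d))[D [D0 Dv DC JD]] : forall r, (r <= d)%N ->
    exists D : {mpoly R[d]}, [/\ D != 0,
    forall m, m \in msupp D -> forall i : 'I_d, (i < r)%N -> m i = 0%N,
    forall m, m \in msupp D -> exists2 m', m' \in msupp C & D@_m = C@_m'
    & J r D.@[x]].
  have D1 : D = (D@_0%MM)%:MP.
    apply/mpolyP => m; rewrite mcoeffC; case: eqP => [->|m0]; first by rewrite mulr1.
    rewrite mulr0; apply: memN_msupp_eq0; apply/negP => /Dv mv; apply: m0.
    by apply/mnmP => i; rewrite mnm0E mv.
  have [|m mC E] := DC 0%MM.
    by rewrite mcoeff_msupp; apply: contra D0 => /eqP e; rewrite D1 e mpolyC0.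
  by exists m => //; rewrite -E; move: JD; rewrite {1}D1 mevalC.
elim=> [_|r IH rd]; first by exists C; split=> // m; exists m.
have [D [D0 Dv DC JD]] := IH (ltnW rd); pose t := Ordinal rd.
have exm : exists e, has (fun m : 'X_{1..d} => m t == e) (msupp D).
  by exists (mlast D t); apply/hasP; exists (mlast D) => //; apply: mlast_supp.
(* The least exponent of T_r in D: the power T_r^e divides D and is cancelled by [J_reg]. *)
pose e := ex_minn exm.
have [em le_e] : has (fun m : 'X_{1..d} => m t == e) (msupp D) /\
    forall m, m \in msupp D -> (e <= m t)%N.
  rewrite /e; case: ex_minnP => e0 H Hmin; split=> // m mD.
  by apply: Hmin; apply/hasP; exists m.
pose u : 'X_{1..d} := (U_(t) *+ e)%MM; pose D' := mdivX u D.
have uE i : u i = if t == i then e else 0%N.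
  by rewrite mulmnE mnm1E; case: (t == i); rewrite ?mul1n.
have le_u m : m \in msupp D -> (u <= m)%MM.
  move=> mD; apply/mnm_lepP => i; rewrite uE; case: eqP => // <-.
  exact: le_e.
have DE : D = 'X_[u] * D'.
  rewrite {1}(mdivXE u D) [msel _ _](_ : _ = 0) ?add0r //.
  apply/mpolyP => m; rewrite mcoeff_msel mcoeff0; case: ifP => // um.
  by apply: memN_msupp_eq0; apply: contra um => /le_u.
have JD' : J r D'.@[x].
  move: JD; rewrite DE mevalM mevalX.
  rewrite (bigD1 t) //= big1 ?mulr1; last first.
    by move=> i /negPf it; rewrite uE eq_sym it expr0.
  rewrite uE eqxx; elim: (e) => [|e' IHe]; first by rewrite expr0 mul1r.
  by rewrite exprS -mulrA => /(@J_reg t); apply: IHe.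
(* Setting T_r = 0 in D' changes the value by a multiple of x_r, which lies in J_(r+1). *)
exists (msel (fun m => ~~ (U_(t) <= m)%MM) D').
have in_supp m : m \in msupp (msel (fun m => ~~ (U_(t) <= m)%MM) D') ->
    (m t == 0%N) /\ (u + m)%MM \in msupp D.
  rewrite mcoeff_msupp mcoeff_msel lep1mP negbK.
  by case: (m t =P 0%N) => _; rewrite ?eqxx // /D' mcoeff_mdivX -mcoeff_msupp.
split.
- have /hasP[m mD /eqP mte] := em.
  have um := le_u m mD; apply/eqP => /(congr1 (mcoeff (m - u)%MM)).
  rewrite mcoeff_msel lep1mP mnmBE uE eqxx mte subnn eqxx /= mcoeff0 /D' mcoeff_mdivX.
  by rewrite addmC submK // => /eqP; rewrite mcoeff_eq0 mD.
- move=> m /in_supp[/eqP mt mD] i; rewrite ltnS leq_eqVlt => /orP[/eqP ir|ir].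
    by rewrite (_ : i = t) //; apply: val_inj.
  have := Dv _ mD i ir; rewrite mnmDE => /eqP; rewrite addn_eq0 => /andP[_ /eqP].
  by [].
- move=> m mS; have [mt mD] := in_supp m mS; have [m' m'C E] := DC _ mD.
  exists m' => //; rewrite -E mcoeff_msel lep1mP negbK mt /D' mcoeff_mdivX.
  by [].
have JI := J_ideal rd.
apply: (is_ideal_addKr (b := ('X_t * mdivX U_(t) D').@[x])) => //.
  by rewrite mevalM mevalXU; apply: is_idealMr => //; apply: (J_x t).
by rewrite -mevalD -mdivXE; apply: (J_sub (i := t)).
Qed.

End LexInitial.

Section AlgebraicDependence.
Variable k : fieldType.

Lemma supp_deg_meval n d (x : 'I_d -> {mpoly k[n]}) E (m : 'X_{1..d}) :
  (forall i, supp_in (fun u => mdeg u <= E)%N (x i)) ->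
  supp_in (fun u => mdeg u <= mdeg m * E)%N ('X_[m] : {mpoly {mpoly k[n]}[d]}).@[x].
Proof.
move=> HE; rewrite mevalX mdegE big_distrl /=.
elim/big_rec2: _ => [|i a b _ IH].
  by move=> u; rewrite msupp1 inE => /eqP ->; rewrite mdeg0.
apply: (supp_inM (a := fun u => (mdeg u <= m i * E)%N) _ _ IH).
  by move=> u v Hu Hv; rewrite mdegD leq_add.
elim: (m i) => [|c IHc]; first by move=> u; rewrite expr0 msupp1 inE => /eqP ->; rewrite mdeg0.
rewrite exprS mulSn; apply: (supp_inM _ (HE i) IHc) => u v Hu Hv.
by rewrite mdegD leq_add.
Qed.

Definition mnm_of_ffun d N (f : {ffun 'I_d -> 'I_N.+1}) : 'X_{1..d} :=
  [multinom (f i : nat) | i < d].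

Lemma mnm_of_ffun_inj d N : injective (@mnm_of_ffun d N).
Proof.
move=> f g /mnmP fg; apply/ffunP => i; apply: val_inj.
by have := fg i; rewrite !mnmE.
Qed.

(* Counting: for N large there are more monomials in the x_i, i in D, of
   partial degrees at most N, than monomials in the variables in H which can
   occur in them. *)
Lemma alg_dependent n d (x : 'I_d -> {mpoly k[n]}) (H : {set 'I_n}) (D : {set 'I_d}) :
  (#|H| < #|D|)%N ->
  exists P : {mpoly k[d]}, [/\ P != 0,
    forall m, m \in msupp P -> forall i, i \notin D -> m i = 0%N
    & forall m : 'X_{1..n}, (forall j, j \notin H -> m j = 0%N) ->
      ((map_mpoly (@mpolyC n k) P).@[x])@_m = 0].
Proof.
move=> HD; pose E := \max_(i < d) msize (x i).
have HE i : supp_in (fun u => mdeg u <= E)%N (x i).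
  move=> u /msize_mdeg_lt lt; apply: leq_trans (ltnW lt) _.
  exact: (leq_bigmax (F := fun i => msize (x i))).
(* M bounds the degree of a product of the x_i with all exponents at most N. The choice of N gives
   (M+1)^h <= (N+1)^h c^h = (N+1)^h N < (N+1)^(h+1) for h = |H|. *)
pose c := (d * E + 1)%N; pose N := (c ^ #|H|)%N; pose M := (d * N * E)%N.
pose I : pred {ffun 'I_d -> 'I_N.+1} := pffun_on ord0 (mem D) predT.
pose L : pred {ffun 'I_n -> 'I_M.+1} := pffun_on ord0 (mem H) predT.
pose mon (i : 'I_#|I|) := mnm_of_ffun (enum_val i).
pose A := \matrix_(i < #|I|, j < #|L|)
  (('X_[mon i] : {mpoly {mpoly k[n]}[d]}).@[x])@_(mnm_of_ffun (enum_val j)).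
have cardIL : (#|L| < #|I|)%N.
  rewrite !card_pffun_on !card_ord.
  apply: (@leq_ltn_trans ((N.+1 * c) ^ #|H|)%N).
    have le : (M.+1 <= N.+1 * c)%N by rewrite /M /c; nia.
    by case: (posnP #|H|) => [->|h0]; rewrite ?expn0 ?leq_exp2r.
  rewrite expnMn -/N; apply: (@leq_trans (N.+1 ^ #|H|.+1)%N).
    by rewrite expnSr ltn_pmul2l // expn_gt0.
  exact: leq_pexp2l.
(* With more rows than columns the rows are linearly dependent; the entries of v become the
   coefficients of P. *)
have /rowV0Pn[v /sub_kermxP vA v0] : kermx A != 0.
  rewrite kermx_eq0 /row_free neq_ltn; apply/orP; left.
  exact: leq_ltn_trans (rank_leq_col A) cardIL.
have mon_inj : injective mon by move=> i j /mnm_of_ffun_inj /enum_val_inj.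
have monP i j : j \notin D -> mon i j = 0%N.
  have /pffun_onP[sub _] := enum_valP i.
  move=> jD; rewrite mnmE; apply/eqP; apply: contraNT jD => ne.
  by apply: (subsetP sub); rewrite inE.
pose P := \sum_i v 0 i *: 'X_[mon i].
have PE i : P@_(mon i) = v 0 i.
  rewrite /P raddf_sum (bigD1 i) //= mcoeffZ mcoeffX eqxx mulr1 big1 ?addr0 // => j ji.
  by rewrite mcoeffZ mcoeffX (inj_eq mon_inj) (negPf ji) mulr0.
exists P; split.
- have [i vi] : exists i, v 0 i != 0.
    apply/existsP; apply: contraR v0 => /existsPn H0; apply/eqP/rowP => i.
    by rewrite mxE; apply/eqP/negbNE/H0.
  by apply: contraTneq vi => P0; rewrite -PE P0 mcoeff0 eqxx.
- have : supp_in (fun m => [forall i, (i \notin D) ==> (m i == 0%N)]) P.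
    apply: supp_in_sum => i _ _; apply: supp_inZX; apply/forallP => j.
    by apply/implyP => /monP ->.
  by move=> HP m /HP /forallP Hm i iD; apply/eqP/(implyP (Hm i)).
move=> m mH; have PxE : (map_mpoly (@mpolyC n k) P).@[x] =
    \sum_i v 0 i *: ('X_[mon i] : {mpoly {mpoly k[n]}[d]}).@[x].
  rewrite /P (raddf_sum (map_mpoly (@mpolyC n k))) (raddf_sum (meval x)); apply: eq_bigr => i _.
  rewrite -[LHS]/((map_mpoly (@mpolyC n k) (v 0 i *: 'X_[mon i])).@[x]).
  by rewrite map_mpolyZ map_mpolyX mevalZ mul_mpolyC.
rewrite PxE raddf_sum /=.
case: (boolP [forall j, (m j <= M)%N]) => mM; last first.
  rewrite big1 // => i _; rewrite mcoeffZ memN_msupp_eq0 ?mulr0 //.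
  apply: contra mM => /(supp_deg_meval HE) le; apply/forallP => j.
  apply: leq_trans (leq_trans le _); first by rewrite mdegE (bigD1 j) //= leq_addr.
  rewrite leq_mul2r; apply/orP; right; rewrite mdegE.
  rewrite -[X in (_ <= X * _)%N](card_ord d) -sum_nat_const; apply: leq_sum => l _.
  by rewrite mnmE -ltnS ltn_ord.
pose f : {ffun 'I_n -> 'I_M.+1} := [ffun j => inord (m j)].
have fL : f \in L.
  apply/pffun_onP; split=> //; apply/subsetP => j; rewrite inE ffunE.
  by apply: contraR => /mH ->; apply/eqP/val_inj; rewrite /= inordK.
have mE : mnm_of_ffun (enum_val (enum_rank_in fL f)) = m.
  apply/mnmP => j; rewrite enum_rankK_in // mnmE ffunE inordK // ltnS.
  exact: (forallP mM).
have /rowP/(_ (enum_rank_in fL f)) := vA; rewrite !mxE => vAE.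
rewrite -[RHS]vAE; apply: eq_bigr => i _.
by rewrite mcoeffZ mxE mE.
Qed.

End AlgebraicDependence.

(** * Regular sequences and the polynomial ring they generate *)

Lemma subr_telescope (A : comNzRingType) (a b q p : A) :
  q - p = (a - b) - (a - q) + (b - p).
Proof. by ring. Qed.

Lemma subr_shift_syzygy (A : comNzRingType) (q a p b w : A) :
  q * (a - p * w) - p * (b - q * w) = q * a - p * b.
Proof. by ring. Qed.

Section RegularSequenceTorsion.
Variables (k : fieldType) (n : nat).
Let S := {mpoly k[n]}.
Variables (J : S -> Prop) (s : seq S).
Let d := size s.
Let x (i : 'I_d) : S := s`_i.
Let K := ideal_add_seq J s.
Let W := power_add d J s d.
Implicit Types (P Q : {mpoly k[d]}) (C B : {mpoly S[d]}) (m u : 'X_{1..d}).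
Let lift P : {mpoly S[d]} := map_mpoly (@mpolyC n k) P.

Hypothesis J_ideal : is_ideal J.
Hypothesis s_reg : quotient_regular_seq J s.
(** Since [W N] is J + (s)^N, this says that S/J is separated in the s-adic topology. *)
Hypothesis J_sep : forall g, (forall N, W N g) -> J g.

Let K_ideal : is_ideal K := ideal_add_seq_ideal J s.

Definition supp_deg_ge N C := supp_in (fun m => N <= mdeg m)%N C.

Lemma supp_deg_geP N C : supp_deg_ge N C <-> supp_in (deg_ge_vars N d) C.
Proof.
split=> H m /H; last by case/andP.
by rewrite /deg_ge_vars => ->; apply/forallP => i; rewrite leqNgt ltn_ord.
Qed.

Lemma regular_initial_coeff N C m :
  supp_deg_ge N C -> J C.@[x] -> mdeg m = N -> K C@_m.
Proof.
move=> /supp_deg_geP HC HJ mN; have [Hreg _] := s_reg.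
have := regular_quasi_regular J_ideal (erefl d) Hreg (leqnn d) HC HJ mN.
by rewrite take_size.
Qed.

Lemma supp_deg_ge_next N C :
  supp_deg_ge N C -> (forall m, mdeg m = N -> K C@_m) -> W N.+1 C.@[x].
Proof.
move=> /supp_deg_geP HC HK; apply: (power_add_eval_next J_ideal (erefl d) HC) => m /HK.
by rewrite take_size.
Qed.

Lemma lift_coeff P m : (lift P)@_m = (P@_m)%:MP.
Proof. exact: mcoeff_map_mpoly. Qed.

Lemma lift_deg_ge P : supp_deg_ge (mdeg (mlast P)) (lift P).
Proof.
move=> m; rewrite mcoeff_msupp lift_coeff mpolyC_eq0 -mcoeff_msupp => /mlast_lemc.
exact: lemc_mdeg.
Qed.

Lemma supp_deg_geM N N' C B : supp_deg_ge N C -> supp_deg_ge N' B -> supp_deg_ge (N + N') (C * B).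
Proof. by apply: supp_inM => m m' Hm Hm'; rewrite mdegD leq_add. Qed.

(** Coefficients in K count as zero, because in lowest degree they can be moved into the next power
    of (s). The monomial order compares degrees first, so the smallest remaining monomial plays the
    part of an initial term. *)
Definition initial_mnm C m := ~ K C@_m /\ forall u, (u < m)%O -> K C@_u.

(** The initial coefficient of P is a nonzero scalar, hence a unit, and multiplying by it keeps an
    element outside K; all other contributions to this coefficient are zero or in K. *)
Lemma initial_mnmM P C m : P != 0 ->
  initial_mnm C m -> initial_mnm (lift P * C) (mlast P + m)%MM.
Proof.
move=> P0 [Cm Cu]; have [Pm Pu] := mlast_min P0.
have [_ KD KM] := K_ideal; split=> [HK|u lt]; last first.
  rewrite mcoeffM; apply: ideal_sum => // -[n1 n2] _ /= /eqP e.
  have [lt1|le1] := ltP (n1 : 'X_{1..d}) (mlast P).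
    by rewrite lift_coeff Pu // mpolyC0 mul0r; case: K_ideal.
  apply: KM; apply: Cu; rewrite ltNge; apply/negP => le2.
  by have := lem_add le1 le2; rewrite -e leNgt lt.
have HM : K ((lift P * C)@_(mlast P + m) - (lift P)@_(mlast P) * C@_m).
  apply: mcoeffM_mod => // n1 n2 e ne; case: (mnm_lt_split e ne) => [lt|lt].
    by rewrite lift_coeff Pu // mpolyC0 mul0r; case: K_ideal.
  by apply: KM; apply: Cu.
have := is_idealB K_ideal HK HM; rewrite opprB addrC subrK lift_coeff.
move/(KM ((P@_(mlast P))^-1)%:MP); rewrite mulrA -mpolyCM mulVf // mpolyC1 mul1r.
by [].
Qed.

(** By separatedness there is an N with g in [W N] but not in [W N.+1]. Then some degree N
    coefficient of a representing C is outside K, and the least such monomial has degree N because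
    the order refines the degree. *)
Lemma exists_initial g : ~ J g -> exists N C m,
  [/\ supp_deg_ge N C, J (g - C.@[x]), mdeg m = N & initial_mnm C m].
Proof.
move=> Jg; have [N WN WSN] : exists2 N, W N g & ~ W N.+1 g.
  apply: NNPP => H; apply: Jg; apply: J_sep; elim=> [|N IH].
    exists g%:MP; split; last by rewrite mevalC subrr; case: J_ideal.
    by apply/supp_deg_geP => m.
  by apply: NNPP => WSN; apply: H; exists N.
have [C [/supp_deg_geP HC JC]] := WN.
have [m0 m0N Km0] : exists2 m, mdeg m = N & ~ K C@_m.
  apply: NNPP => H; apply: WSN; rewrite -(subrK C.@[x] g).
  have [_ WD _] : is_ideal (W N.+1) by apply: power_add_ideal.
  apply: WD; first exact: power_addW.
  by apply: supp_deg_ge_next => // m mN; apply: NNPP => Km; apply: H; exists m.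
have [m Km Hm] := @ex_min_mnm _ (fun m => ~ K C@_m) _ Km0.
have lemm0 : (m <= m0)%O by rewrite leNgt; apply/negP => /Hm; apply.
exists N, C, m; split; [exact: HC|exact: JC| |].
  2: by split; [exact: Km|move=> u /Hm /NNPP; apply].
apply/eqP; rewrite eqn_leq; apply/andP; split; first by rewrite -m0N; apply: lemc_mdeg.
rewrite leqNgt; apply/negP => lt; apply: Km.
rewrite (_ : C@_m = 0); first by case: K_ideal.
by move/supp_inP: HC; apply; rewrite -ltnNge.
Qed.

Lemma lift_evalM_mod P C g :
  J (g - C.@[x]) -> J ((lift P).@[x] * g - (lift P * C).@[x]).
Proof.
by move=> Jg; rewrite mevalM -mulrBr; case: J_ideal => _ _; apply.
Qed.

(** If g were nonzero modulo J, the product of the initial terms of P and of a representative of g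
    would contradict quasi-regularity. *)
Lemma regular_torsion_free P g : P != 0 -> J ((lift P).@[x] * g) -> J g.
Proof.
move=> P0 JPg; apply: NNPP => /exists_initial[N [C [m [HC JC mN Cm]]]].
have [+ _] := initial_mnmM P0 Cm; apply.
apply: (regular_initial_coeff (N := mdeg (mlast P) + N)); last by rewrite mdegD mN.
  by apply: supp_deg_geM => //; apply: lift_deg_ge.
rewrite (_ : _.@[x] = (lift P).@[x] * g - ((lift P).@[x] * g - (lift P * C).@[x])).
  exact: is_idealB J_ideal JPg (lift_evalM_mod P JC).
by rewrite opprB addrC subrK.
Qed.

(** * Division by P(s) via initial terms *)

Section Division.
Variables (P : {mpoly k[d]}) (Q : 'I_d -> {mpoly k[d]}).
Hypothesis P0 : P != 0.
Hypothesis Q0 : forall i, Q i != 0.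
Hypothesis Qvar : forall i m, m \in msupp (Q i) -> m i = 0%N.

(** The relation Q_i a = P b_i modulo J forces the initial monomials of both sides to agree. As Q_i
    is free of T_i, the exponent of T_i in the initial monomial of P is at most that in m; this
    holds for every i. *)
Lemma initial_divisible C a (b : 'I_d -> S) N m :
  supp_deg_ge N C -> J (a - C.@[x]) -> mdeg m = N -> initial_mnm C m ->
  (forall i, J ((lift (Q i)).@[x] * a - (lift P).@[x] * b i)) ->
  (mlast P <= m)%MM.
Proof.
move=> HC JC mN Cm HJ; have [_ JD JM] := J_ideal; apply/mnm_lepP => i.
have Ja : ~ J a.
  move=> Ja; have [+ _] := Cm; apply; apply: (regular_initial_coeff HC) => //.
  by rewrite -(subKr a C.@[x]); apply: is_idealB.
have Jb : ~ J (b i).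
  move=> Jb; apply: Ja; apply: (regular_torsion_free (Q0 i)).
  rewrite -(subrK ((lift P).@[x] * b i) (_ * a)); apply: JD => //.
  exact: JM.
have [N' [B [m' [HB JB mN' Bm']]]] := exists_initial Jb.
have [QC QCu] := initial_mnmM (Q0 i) Cm.
have [PB PBu] := initial_mnmM P0 Bm'.
pose D := lift (Q i) * C - lift P * B.
have JDx : J D.@[x].
  rewrite mevalB; set q := (_ * C).@[x]; set p := (_ * B).@[x].
  have Jq := lift_evalM_mod (Q i) JC; have Jp := lift_evalM_mod P JB.
  rewrite (subr_telescope ((lift (Q i)).@[x] * a) ((lift P).@[x] * b i)).
  exact: JD _ _ (is_idealB J_ideal (HJ i) Jq) Jp.
have lowQ : supp_deg_ge (mdeg (mlast (Q i) + m)%MM) (lift (Q i) * C).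
  by rewrite mdegD mN; apply: supp_deg_geM => //; apply: lift_deg_ge.
have lowP : supp_deg_ge (mdeg (mlast P + m')%MM) (lift P * B).
  by rewrite mdegD mN'; apply: supp_deg_geM => //; apply: lift_deg_ge.
(* If they differed, the smaller of the two would keep a coefficient outside K in D, although D(s)
   lies in J. *)
have [lt|gt|e] := ltgtP (mlast (Q i) + m)%MM (mlast P + m')%MM.
- case: QC; apply: (is_ideal_addKr (b := - (lift P * B)@_(mlast (Q i) + m))) => //.
    by apply: is_idealN => //; apply: PBu.
  rewrite -mcoeffB; apply: (regular_initial_coeff _ JDx (erefl _)).
  apply: supp_inB; first exact: lowQ.
  move=> u /lowP; apply: leq_trans.
  by apply: lemc_mdeg; apply: ltW.
- case: PB; rewrite -(opprK (_@__)); apply: is_idealN => //.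
  apply: (is_ideal_addKr (b := (lift (Q i) * C)@_(mlast P + m'))) => //.
    exact: QCu.
  rewrite addrC -mcoeffB; apply: (regular_initial_coeff _ JDx (erefl _)).
  apply: supp_inB; last exact: lowP.
  move=> u /lowQ; apply: leq_trans.
  by apply: lemc_mdeg; apply: ltW.
have /mnmP/(_ i) := e; rewrite !mnmDE.
by rewrite (Qvar (i := i)) ?mlast_supp // add0n => ->; rewrite leq_addr.
Qed.

(** A division algorithm: multiples of P cancel the initial terms of degree N one after another, and
    subtracting P w from a is matched by subtracting Q_i w from b_i. *)
Lemma regular_division_step N a b : W N a ->
  (forall i, J ((lift (Q i)).@[x] * a - (lift P).@[x] * b i)) ->
  exists w, W N.+1 (a - (lift P).@[x] * w).
Proof.
case=> C [/supp_deg_geP HC JC] HJ.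
(* The induction is on a bound c for the number of monomials of degree at most N not below a degree
   N monomial with coefficient outside K. *)
have [c] : exists c, forall m, mdeg m = N -> ~ K C@_m ->
    (#|[pred u : 'X_{1..d < N.+1} | (m <= u)%O]| <= c)%N.
  by exists #|{: 'X_{1..d < N.+1}}| => m _ _; apply: max_card.
have [_ JD JM] := J_ideal; have [_ WD _] : is_ideal (W N.+1) by apply: power_add_ideal.
elim: c a b C HC JC HJ => [|c IH] a b C HC JC HJ Hc.
  exists 0; rewrite mulr0 subr0 -(subrK C.@[x] a).
  apply: WD; first exact: power_addW.
  apply: supp_deg_ge_next => // m mN; apply: NNPP => Km; have := Hc m mN Km.
  have lt : (mdeg m < N.+1)%N by rewrite mN.
  by rewrite leqn0 => /eqP/card0_eq/(_ (BMultinom lt)); rewrite !inE lexx.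
case: (classic (forall m, mdeg m = N -> K C@_m)) => [HK|].
  exists 0; rewrite mulr0 subr0 -(subrK C.@[x] a).
  by apply: WD; [exact: power_addW|exact: supp_deg_ge_next].
move=> /not_all_ex_not[m0 Hm0]; have [m0N Km0] := imply_to_and _ _ Hm0.
have [m Km Hm] := @ex_min_mnm _ (fun m => ~ K C@_m) _ Km0.
have mN : mdeg m = N.
  have lemm0 : (m <= m0)%O by rewrite leNgt; apply/negP => /Hm; apply.
  apply/eqP; rewrite eqn_leq; apply/andP; split; first by rewrite -m0N; apply: lemc_mdeg.
  rewrite leqNgt; apply/negP => lt; apply: Km.
  rewrite (_ : C@_m = 0); first by case: K_ideal.
  by move/supp_inP: HC; apply; rewrite -ltnNge.
have Cm : initial_mnm C m by split; [exact: Km|move=> u /Hm /NNPP; apply].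
have le := initial_divisible HC JC mN Cm HJ.
have [Pm Pu] := mlast_min P0.
(* T is chosen so that the product of P and T agrees with C at m and has no smaller monomial. *)
pose t := ((P@_(mlast P))^-1)%:MP * C@_m; pose u := (m - mlast P)%MM.
pose T : {mpoly S[d]} := t *: 'X_[u]; pose w := T.@[x].
have uE : (mlast P + u)%MM = m by rewrite addmC submK.
have lowT : supp_deg_ge N (lift P * T).
  rewrite -mN -uE mdegD; apply: supp_deg_geM; first exact: lift_deg_ge.
  exact: supp_inZX.
have PTm : (lift P * T)@_m = C@_m.
  rewrite -{1}uE -scalerAr mcoeffZ addmC mcoeffMX lift_coeff mulrC mulrA -mpolyCM.
  by rewrite mulfV // mpolyC1 mul1r.
have PTv v : (v < m)%O -> (lift P * T)@_v = 0.
  move=> lt; apply: memN_msupp_eq0; apply/negP => /msuppM_le /allpairsP[[v1 v2] /=].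
  rewrite mcoeff_msupp lift_coeff mpolyC_eq0 -mcoeff_msupp => -[Pv1 /msuppZ_le].
  rewrite msuppX inE => /eqP -> vE; move: lt; rewrite vE -uE ltmc_add2l.
  by rewrite ltNge mlast_lemc.
have [||||w' Hw'] := IH (a - (lift P).@[x] * w) (fun i => b i - (lift (Q i)).@[x] * w)
    (C - lift P * T).
- exact: supp_inB.
- by rewrite mevalB mevalM -/w opprB addrA subrK.
- move=> i; rewrite subr_shift_syzygy; exact: HJ.
- move=> v vN Kv; rewrite -ltnS; apply: leq_trans (Hc m mN Km).
  have lt_mv : (m < v)%O.
    rewrite ltNge le_eqVlt; apply/negP => /orP[/eqP e|lt]; apply: Kv.
      by rewrite e mcoeffB PTm subrr; case: K_ideal.
    by rewrite mcoeffB PTv // subr0; case: Cm => _; apply.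
  have ltm : (mdeg m < N.+1)%N by rewrite mN.
  apply: proper_card; apply/properP; split.
    by apply/subsetP => z; rewrite !inE; apply: le_trans; apply: ltW.
  by exists (BMultinom ltm); rewrite !inE ?lexx //= -ltNge.
exists (w + w'); by rewrite mulrDr opprD addrA.
Qed.

(* S/J satisfies Serre's condition (S_2) with respect to k[s_1, ..., s_d], up
   to completion: the Q_i play the role of an ideal of height at least two. *)
Lemma regular_division a b :
  (forall i, J ((lift (Q i)).@[x] * a - (lift P).@[x] * b i)) ->
  forall N, exists w, W N (a - (lift P).@[x] * w).
Proof.
move=> HJ; elim=> [|N [w Hw]].
  exists 0; exists a%:MP; split; first by apply/supp_deg_geP => m.
  by rewrite mulr0 subr0 mevalC subrr; case: J_ideal.
have [|w' Hw'] := regular_division_step (b := fun i => b i - (lift (Q i)).@[x] * w) Hw.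
  by move=> i; rewrite subr_shift_syzygy; apply: HJ.
exists (w + w'); by rewrite mulrDr opprD addrA.
Qed.

End Division.
End RegularSequenceTorsion.

(** * Ideals generated by variables *)

Section MonomialIdeals.
Variables (k : fieldType) (n : nat).
Local Notation S := {mpoly k[n]}.
Implicit Types (m u : 'X_{1..n}) (A B F H : {set 'I_n}) (f g p w : S).

Definition degin A m := (\sum_(j in A) m j)%N.

Lemma deginD A m u : degin A (m + u)%MM = (degin A m + degin A u)%N.
Proof. by rewrite /degin -big_split; apply: eq_bigr => j _; rewrite mnmDE. Qed.

Lemma deginU A j : degin A U_(j)%MM = (j \in A).
Proof.
rewrite /degin; case: (boolP (j \in A)) => jA.
  rewrite (bigD1 j) //= mnm1E eqxx big1 ?addn0 // => i /andP[_ /negPf].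
  by rewrite mnm1E eq_sym => ->.
apply: big1 => i iA; rewrite mnm1E; case: eqP => // e.
by rewrite e iA in jA.
Qed.

Lemma degin_eq0 A m : (degin A m == 0%N) = [forall j in A, m j == 0%N].
Proof. exact: sum_nat_eq0. Qed.

Lemma degin_gt0P A m : reflect (exists2 j, j \in A & m j != 0%N) (0 < degin A m)%N.
Proof.
rewrite lt0n degin_eq0 negb_forall; apply: (iffP existsP) => [[j]|[j jA mj]].
  by rewrite negb_imply => /andP[]; exists j.
by exists j; rewrite jA.
Qed.

Lemma degin_sub A B m : A \subset B -> (degin A m <= degin B m)%N.
Proof.
move=> /subsetP AB; rewrite /degin [X in (_ <= X)%N](bigID (mem A)) /=.
rewrite [X in (_ <= X + _)%N](eq_bigl (mem A)) ?leq_addr // => j /=.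
by case: (boolP (j \in A)) => [/AB ->|]; rewrite ?andbF.
Qed.

Lemma degin_setT m : degin [set: 'I_n] m = mdeg m.
Proof. by rewrite mdegE; apply: eq_bigl => j; rewrite inE. Qed.

Lemma supp_in_ideal (a : pred 'X_{1..n}) :
  (forall u m, a m -> a (u + m)%MM) -> is_ideal (@supp_in k n a).
Proof.
move=> Ha; split; [exact: supp_in0|exact: supp_inD|] => f g ag.
by apply: (supp_inM (a := predT) _ _ ag) => // u m _; apply: Ha.
Qed.

(** Monomials of the c-th power of the ideal P_A generated by the variables in A; the cases c = 1
    and c = 2 are identified below. *)
Definition degin_ge (c : nat) A : pred 'X_{1..n} := fun m => (c <= degin A m)%N.

Lemma degin_ge_ideal c A : is_ideal (@supp_in k n (degin_ge c A)).
Proof.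
apply: supp_in_ideal => u m; rewrite /degin_ge deginD => /leq_trans; apply.
exact: leq_addl.
Qed.

Lemma monomial_ideal_sub (a : pred 'X_{1..n}) (I : S -> Prop) : is_ideal I ->
  (forall m, a m -> I 'X_[m]) -> forall f, supp_in a f -> I f.
Proof.
move=> HI Ha f af; rewrite [f]mpolyE; apply: ideal_sum => // m /af /Ha Im _.
by rewrite -mul_mpolyC; case: HI => _ _; apply.
Qed.

Lemma var_idealP A f : var_ideal A f <-> supp_in (degin_ge 1 A) f.
Proof.
split.
  apply: ideal_gen_min; first exact: degin_ge_ideal.
  by move=> g [j jA ->]; apply: supp_inX; rewrite /degin_ge deginU jA.
apply: monomial_ideal_sub; first exact: ideal_gen_ideal.
move=> m /degin_gt0P[j jA mj]; have le : (U_(j) <= m)%MM by rewrite lep1mP.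
rewrite -(submK le) mpolyXD; case: (ideal_gen_ideal (fun f : S => exists2 j, j \in A & f = 'X_j)).
by move=> _ _; apply; apply: ideal_genW; exists j.
Qed.

Lemma var_ideal_sqP A f :
  ideal_mul (var_ideal A) (var_ideal A) f <-> supp_in (degin_ge 2 A) f.
Proof.
split.
  apply: ideal_gen_min; first exact: degin_ge_ideal.
  move=> g [a [b [/var_idealP Ia /var_idealP Ib ->]]].
  apply: supp_inM Ia Ib => m u; rewrite /degin_ge deginD; exact: (@leq_add 1 1).
apply: monomial_ideal_sub; first exact: ideal_gen_ideal.
move=> m Hm; have /degin_gt0P[j jA mj] : (0 < degin A m)%N by exact: leq_trans Hm.
have le : (U_(j) <= m)%MM by rewrite lep1mP.
rewrite -(submK le) mpolyXD; apply: ideal_genW; exists 'X_[m - U_(j)], 'X_j.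
split=> //; apply/var_idealP; apply: supp_inX.
  by move: Hm; rewrite /degin_ge -{1}(submK le) deginD deginU jA addn1 ltnS.
by rewrite /degin_ge deginU jA.
Qed.

Lemma min_mnm_degin A f c m1 : f@_m1 != 0 -> degin A m1 = c ->
  exists m, [/\ f@_m != 0, degin A m = c, (m <= m1)%O
    & forall u, (u < m)%O -> degin A u = c -> f@_u = 0].
Proof.
move=> f1 c1; have H1 : f@_m1 != 0 /\ degin A m1 = c by [].
have [m [fm mc] Hm] := @ex_min_mnm _ (fun m => f@_m != 0 /\ degin A m = c) _ H1.
exists m; split=> //; first by rewrite leNgt; apply/negP => /Hm; apply.
move=> u lt uc; apply/eqP; apply: contraT => fu.
by case: (Hm u lt).
Qed.

Lemma notin_var_ideal A f : ~ var_ideal A f -> exists m, [/\ f@_m != 0,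
  degin A m = 0%N & forall u, (u < m)%O -> degin A u = 0%N -> f@_u = 0].
Proof.
move=> If; have [m1 f1 m10] : exists2 m, f@_m != 0 & degin A m = 0%N.
  apply: NNPP => H; apply: If; apply/var_idealP => m mf.
  rewrite /degin_ge lt0n; apply/eqP => m0; apply: H.
  by exists m; rewrite -?mcoeff_msupp.
by have [m [fm m0 _ Hm]] := min_mnm_degin f1 m10; exists m.
Qed.

Lemma mcoeffM_eq f g m u :
  (forall n1 n2, (n1 + n2 = m + u)%MM -> n1 != m -> f@_n1 * g@_n2 = 0) ->
  (f * g)@_(m + u) = f@_m * g@_u.
Proof.
move=> H; apply/eqP; rewrite -subr_eq0; apply/eqP.
apply: (mcoeffM_mod (I := fun c : k => c = 0)) => //.
by split=> [//|a b -> ->|a b ->]; rewrite ?addr0 ?mulr0.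
Qed.

(** The smallest terms of f and g free of the variables in A multiply without cancellation, since a
    factor of a monomial free of A is free of A. *)
Lemma var_ideal_prime A : prime_ideal (@var_ideal k n A).
Proof.
split; first exact: ideal_gen_ideal.
  move/var_idealP => /(_ 0%MM); rewrite msupp1 inE eqxx => /(_ isT).
  by rewrite /degin_ge /degin big1 // => j _; rewrite mnm0E.
move=> f g Ifg; apply: NNPP.
move=> /not_or_and[/notin_var_ideal[m [fm m0 Hm]] /notin_var_ideal[u [gu u0 Hu]]].
have fgE : (f * g)@_(m + u) = f@_m * g@_u.
  apply: mcoeffM_eq => n1 n2 e ne.
  have /eqP : degin A (n1 + n2)%MM = 0%N by rewrite e deginD m0 u0.
  rewrite deginD addn_eq0 => /andP[/eqP d1 /eqP d2].
  by case: (mnm_lt_split e ne) => lt; [rewrite Hm // mul0r|rewrite Hu // mulr0].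
move/var_idealP/supp_inP: Ifg => /(_ (m + u)%MM).
rewrite /degin_ge deginD m0 u0 fgE => /(_ isT) /eqP.
by rewrite mulf_eq0 (negPf fm) (negPf gu).
Qed.

(* Modulo P_A^2, multiplication by p raises the order of an element by a bounded
   amount; N0 accounts for this loss. *)
Lemma var_ideal_sq_primary A p : ~ var_ideal A p -> exists N0, forall N, (N0 <= N)%N ->
  forall w, supp_in (fun m => degin_ge 2 A m || (N <= mdeg m)%N) (p * w) ->
  forall m, degin A m = 1%N -> mdeg m = 2%N -> w@_m = 0.
Proof.
(* First the terms of w free of A and of low degree are shown to vanish, then those of A-degree one.
   In the second stage a cofactor free of A has degree at most mdeg t + 2, and the first stage
   applies to it when 2 mdeg t + 2 < N. *)
move=> /notin_var_ideal[t [pt t0 Ht]]; exists (2 * mdeg t + 3)%N => N HN w Hw m m1 m2.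
have w0 u : degin A u = 0%N -> (mdeg u + mdeg t < N)%N -> w@_u = 0.
  move=> u0 uN; apply/eqP; apply: contraT => wu.
  have [v [wv v0 vu Hv]] := min_mnm_degin wu u0.
  have pwE : (p * w)@_(t + v) = p@_t * w@_v.
    apply: mcoeffM_eq => n1 n2 e ne.
    have /eqP : degin A (n1 + n2)%MM = 0%N by rewrite e deginD t0 v0.
    rewrite deginD addn_eq0 => /andP[/eqP d1 /eqP d2].
    by case: (mnm_lt_split e ne) => lt; [rewrite Ht // mul0r|rewrite Hv // mulr0].
  move/supp_inP: Hw => /(_ (t + v)%MM); rewrite /degin_ge deginD t0 v0 /= -ltnNge mdegD.
  rewrite (leq_ltn_trans _ uN) => [/(_ isT)/eqP|]; last first.
    by rewrite addnC leq_add2r lemc_mdeg.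
  by rewrite pwE mulf_eq0 (negPf pt) (negPf wv).
apply/eqP; apply: contraT => wm.
have [v [wv v1 vm Hv]] := min_mnm_degin wm m1; have := lemc_mdeg vm; rewrite m2 => v2.
have pwE : (p * w)@_(t + v) = p@_t * w@_v.
  apply: mcoeffM_eq => n1 n2 e ne.
  have : degin A (n1 + n2)%MM = 1%N by rewrite e deginD t0 v1.
  rewrite deginD; case d2 : (degin A n2) => [|[|c]]; rewrite ?addnS => // d1.
    rewrite [w@_n2]w0 ?mulr0 //; have : mdeg (n1 + n2)%MM = mdeg (t + v)%MM by rewrite e.
    by rewrite !mdegD; lia.
  have {}d1 : degin A n1 = 0%N by lia.
  by case: (mnm_lt_split e ne) => lt; [rewrite Ht // mul0r|rewrite Hv // mulr0].
move/supp_inP: Hw => /(_ (t + v)%MM); rewrite /degin_ge deginD t0 v1 /= -ltnNge mdegD.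
rewrite (_ : (_ < N)%N); last by lia.
by move=> /(_ isT)/eqP; rewrite pwE mulf_eq0 (negPf pt) (negPf wv).
Qed.

End MonomialIdeals.

(** * Chains of primes and regular sequences modulo I(G)^(2) *)

Section SymbolicSquare.
Variables (k : fieldType) (n : nat) (e : rel 'I_n).
Local Notation S := {mpoly k[n]}.
Local Notation J := (@second_symbolic_power k n e).
Implicit Types (m u : 'X_{1..n}) (F H : {set 'I_n}) (f g p w : S).

Lemma symbolic_sqP f :
  J f <-> forall F, maxset (independent e) F -> supp_in (degin_ge 2 (~: F)) f.
Proof. by split=> HF F /HF /var_ideal_sqP. Qed.

Lemma symbolic_sq_ideal : is_ideal J.
Proof. by apply: ideal_cap_ideal => F _; apply: ideal_gen_ideal. Qed.

Lemma symbolic_sq_supp f g : {subset msupp f <= msupp g} -> J g -> J f.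
Proof. by move=> sub /symbolic_sqP H; apply/symbolic_sqP => F /H Hg m /sub /Hg. Qed.

Lemma power_add_max d s N g : (forall f, f \in s -> var_ideal [set: 'I_n] f) ->
  size s = d -> power_add d J s d N g ->
  exists2 r, J (g - r) & supp_in (fun m => N <= mdeg m)%N r.
Proof.
move=> Hs size_s [C [HC JC]]; exists C.@[fun i : 'I_d => s`_i] => //.
rewrite mevalE; apply: supp_in_sum => c /HC /andP[Nc _] _.
apply: (supp_inM (a := predT) (b := fun m => (mdeg c <= mdeg m)%N)) => //.
  by move=> m u _ Hu; rewrite mdegD (leq_trans Nc) // (leq_trans Hu) ?leq_addl.
rewrite mdegE; elim/big_rec2: _ => [|i f a _ IH]; first by move=> u.
apply: (supp_inM (a := fun m => (c i <= mdeg m)%N) _ _ IH).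
  by move=> m u Hm Hu; rewrite mdegD leq_add.
elim: (c i) => [|b IHb]; first by move=> u.
rewrite exprS; apply: (supp_inM _ _ IHb (a := degin_ge 1 [set: 'I_n])).
  by move=> m u; rewrite /degin_ge degin_setT mdegD => Hm Hu; rewrite -add1n leq_add.
by apply/var_idealP/Hs/mem_nth; rewrite size_s.
Qed.

(** J is monomial, so each term of g can be tested alone. Modulo J, g equals some r whose terms all
    have larger degree than the tested monomial m, so m occurs in g - r, an element of J. *)
Lemma symbolic_sq_separated d s g : (forall f, f \in s -> var_ideal [set: 'I_n] f) ->
  size s = d -> (forall N, power_add d J s d N g) -> J g.
Proof.
move=> Hs size_s HW; rewrite [g]mpolyE; apply: ideal_sum; first exact: symbolic_sq_ideal.
move=> m mg _; have [r Jr Hr] := power_add_max Hs size_s (HW (mdeg m).+1).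
apply: symbolic_sq_supp Jr => u /msuppZ_le; rewrite msuppX inE => /eqP ->.
rewrite mcoeff_msupp mcoeffB (_ : r@_m = 0) ?subr0 -?mcoeff_msupp //.
by move/supp_inP: Hr; apply; rewrite ltnn.
Qed.

Lemma independent_sub F H : F \subset H -> independent e H -> independent e F.
Proof.
move=> /subsetP sub /forall_inP HH; apply/forall_inP => i /sub iH.
by apply/forall_inP => j /sub jH; have /forall_inP := HH i iH; apply.
Qed.

Lemma symbolic_sq_sub_var F (A : {set 'I_n}) f : independent e F ->
  ~: F \subset A -> J f -> var_ideal A f.
Proof.
move=> /maxset_exists[H maxH FH] FA /symbolic_sqP/(_ H maxH) Hf.
apply/var_idealP; apply: supp_in_sub Hf => m; rewrite /degin_ge => /ltnW/leq_trans; apply.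
by apply: degin_sub; apply: subset_trans FA; rewrite setCS.
Qed.

(** The chain starts at P_F and adjoins the variables of F one at a time. *)
Lemma independent_chain F : independent e F -> exists Q, prime_chain J #|F| Q.
Proof.
move=> indF; pose A i := ~: F :|: [set j in take i (enum F)].
exists (fun i => var_ideal (A i)); split=> [i _|i iF].
  split; first exact: var_ideal_prime.
  by move=> f; apply: symbolic_sq_sub_var indF _; apply: subsetUl.
have AS : A i \subset A i.+1.
  apply: setUS; apply/subsetP => j; rewrite !inE.
  by rewrite -(subnKC (leqnSn i)) takeD mem_cat => ->.
split=> [f|].
  move=> /var_idealP Hf; apply/var_idealP; apply: supp_in_sub Hf => m.
  by rewrite /degin_ge => /leq_trans; apply; apply: degin_sub.
have [x0 _] : exists x0 : 'I_n, x0 \in F by apply/card_gt0P; apply: leq_trans iF.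
have szF : (i < size (enum F))%N by rewrite -cardE.
pose j := nth x0 (enum F) i.
have jF : j \in F by rewrite -mem_enum mem_nth.
move=> /(_ 'X_j) H; have : var_ideal (A i.+1) ('X_j : S).
  apply: ideal_genW; exists j => //; rewrite !inE; apply/orP; right.
  by rewrite /j -(nth_take x0 (ltnSn i)) mem_nth // size_takel.
move/H/var_idealP => /(_ U_(j)%MM); rewrite msuppX inE eqxx => /(_ isT).
rewrite /degin_ge deginU !inE jF /= lt0b; apply/negP.
apply/negP => /(nthP x0)[l]; rewrite size_takel; last exact: ltnW.
move=> li.
rewrite nth_take // => /eqP; rewrite nth_uniq ?enum_uniq //; first by rewrite ltn_eqF.
exact: ltn_trans li szF.
Qed.

(** The product over all H of the individual dependences serves all H at once; an H that is too
    large contributes the factor 1. *)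
Lemma alg_dependent_all d (x : 'I_d -> S) (D : {set 'I_d}) :
  exists P : {mpoly k[d]}, [/\ P != 0,
    forall m : 'X_{1..d}, m \in msupp P -> forall i, i \notin D -> m i = 0%N
    & forall H, (#|H| < #|D|)%N ->
      supp_in (degin_ge 1 (~: H)) (map_mpoly (@mpolyC n k) P).@[x]].
Proof.
have /fin_all_exists[P HP] H : exists P : {mpoly k[d]}, [/\ P != 0,
    supp_in (fun m : 'X_{1..d} => [forall i, (i \notin D) ==> (m i == 0%N)]) P
    & (#|H| < #|D|)%N -> supp_in (degin_ge 1 (~: H)) (map_mpoly (@mpolyC n k) P).@[x]].
  case: (ltnP #|H| #|D|) => HD; last first.
    exists 1; split; [exact: oner_neq0| |by []].
    by move=> m; rewrite msupp1 inE => /eqP ->; apply/forallP => i; rewrite mnm0E implybT.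
  have [P [P0 Pv PH]] := alg_dependent x HD; exists P; split=> //.
    by move=> m /Pv mv; apply/forallP => i; apply/implyP => /mv ->.
  move=> _; apply/supp_inP => m; rewrite /degin_ge -leqNgt leqn0 degin_eq0 => /forall_inP Hm.
  by apply: PH => j jH; apply/eqP; apply: Hm; rewrite inE.
exists (\prod_H P H); split.
- by apply/prodf_neq0 => H _; case: (HP H).
- move=> m mP i iD; suff : supp_in (fun m : 'X_{1..d} => [forall i, (i \notin D) ==> (m i == 0%N)])
      (\prod_H P H).
    by move=> /(_ m mP) /forallP/(_ i)/implyP/(_ iD)/eqP.
  elim/big_rec: _ => [|H q _ IH].
    by move=> u; rewrite msupp1 inE => /eqP ->; apply/forallP => j; rewrite mnm0E implybT.
  have [_ PHv _] := HP H.
  apply: supp_inM PHv IH => u v /forallP Hu /forallP Hv; apply/forallP => j.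
  by apply/implyP => jD; rewrite mnmDE (eqP (implyP (Hu j) jD)) (eqP (implyP (Hv j) jD)).
move=> H HD; have [_ _ /(_ HD) PH] := HP H.
have prodE : \prod_H P H = P H * \prod_(H' | H' != H) P H'.
  by rewrite (bigD1 H).
move: (\prod_(_ | _) _) prodE => q ->.
rewrite (rmorphM (map_mpoly (@mpolyC n k))).
rewrite mevalM.
exact: is_idealMr (degin_ge_ideal _ _ _) PH.
Qed.

Lemma alg_dependent_symbolic_sq d (x : 'I_d -> S) :
  (forall F, maxset (independent e) F -> (#|F| < d)%N) ->
  exists2 P : {mpoly k[d]}, P != 0 & J (map_mpoly (@mpolyC n k) P).@[x].
Proof.
move=> HF; have [P [P0 _ PH]] := alg_dependent_all x [set: 'I_d].
(* P(x) lies in every P_F, and squaring moves it into every P_F^2. *)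
exists (P * P); first by rewrite mulf_neq0.
apply/symbolic_sqP => F maxF; rewrite rmorphM mevalM.
have Pm : supp_in (degin_ge 1 (~: F)) (map_mpoly (@mpolyC n k) P).@[x].
  by apply: PH; rewrite cardsT card_ord; apply: HF.
by apply: (supp_inM _ Pm Pm) => m u; rewrite /degin_ge deginD; apply: (@leq_add 1 1).
Qed.

(** The common core of the bounds on dimension and depth: the algebraic dependence has scalar
    coefficients, so the coefficient found by [lex_initial] is a unit in I_d. *)
Lemma lex_chain_bound d (I : nat -> S -> Prop) (x : 'I_d -> S) :
  (forall F, maxset (independent e) F -> (#|F| < d)%N) ->
  (forall r, (r <= d)%N -> is_ideal (I r)) ->
  (forall f, J f -> I 0 f) ->
  (forall (i : 'I_d) g, I i g -> I i.+1 g) ->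
  (forall i : 'I_d, I i.+1 (x i)) ->
  (forall (i : 'I_d) g, I i (x i * g) -> I i g) -> I d 1.
Proof.
move=> HF HI JI Isub Ix Ireg; have [P P0 JP] := alg_dependent_symbolic_sq x HF.
have lc (m : 'X_{1..d}) : (map_mpoly (@mpolyC n k) P)@_m = (P@_m)%:MP by apply: mcoeff_map_mpoly.
have P1 : map_mpoly (@mpolyC n k) P != 0.
  apply: contraNneq P0 => P1; apply/eqP/mpolyP => m; apply/eqP.
  by rewrite mcoeff0 -(mpolyC_eq0 n) -lc P1 mcoeff0.
have [m] := lex_initial HI Isub Ix Ireg P1 (JI _ JP).
rewrite mcoeff_msupp lc mpolyC_eq0 => Pm; have [_ _ IM] := HI d (leqnn d).
by move/(IM ((P@_m)^-1)%:MP); rewrite -mpolyCM mulVf.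
Qed.

Lemma symbolic_sq_chain_bound c d Q :
  (forall F, maxset (independent e) F -> (#|F| <= c)%N) ->
  prime_chain J d Q -> (d <= c)%N.
Proof.
move=> Hc [HQ HS]; rewrite leqNgt; apply/negP => cd.
(* Elements a_i of Q_(i+1) outside Q_i; primality of Q_i makes a_i cancellable modulo Q_i. *)
have [a Ha] : exists a : 'I_d -> S, forall i : 'I_d, Q i.+1 (a i) /\ ~ Q i (a i).
  apply: (fin_all_exists (P := fun (i : 'I_d) f => Q i.+1 f /\ ~ Q i f)) => i.
  have [_ Hn] := HS i (ltn_ord i).
  apply: NNPP => H; apply: Hn => f Qf; apply: NNPP => Qf'; apply: H; by exists f.
have : Q d 1.
  apply: (@lex_chain_bound d Q a) => [F /Hc le|r /HQ[[]]//|f|i g|i|i g].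
  - exact: leq_ltn_trans le cd.
  - by have [_ /(_ f)] := HQ 0%N (leq0n d).
  - by have [/(_ g)] := HS i (ltn_ord i).
  - by case: (Ha i).
  have [[_ _ Qp] _] := HQ i (ltnW (ltn_ord i)).
  by case/Qp => // Qa; case: (Ha i).
by have [[_ + _] _] := HQ d (leqnn d).
Qed.

Lemma symbolic_sq_regular_bound c s :
  (forall F, maxset (independent e) F -> (#|F| <= c)%N) ->
  quotient_regular_seq J s -> (size s <= c)%N.
Proof.
move=> Hc [Hreg H1]; rewrite leqNgt; apply/negP => cs; apply: H1.
rewrite -(take_size s).
apply: (@lex_chain_bound (size s) (fun r => ideal_add_seq J (take r s)) (fun i => s`_i)).
- by move=> F /Hc le; apply: leq_ltn_trans le cs.
- by move=> r _; apply: ideal_add_seq_ideal.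
- by move=> f; apply: ideal_add_seqW.
- move=> i g; apply: ideal_add_seq_mono => y.
  by rewrite -(subnKC (leqnSn i)) takeD mem_cat => ->.
- move=> i; apply: ideal_add_seq_mem.
  by rewrite -(nth_take 0 (ltnSn i)) mem_nth // size_takel.
by move=> i g; apply: Hreg.
Qed.

End SymbolicSquare.

(** * Consequences of the Cohen-Macaulay property *)

Section SyzygyIdentities.
Variable A : comNzRingType.
Implicit Types a b c f g p q r w : A.

Lemma syzygy_factor q p f a b : q * (f * a) - p * (f * b) = f * (q * a - p * b).
Proof. by ring. Qed.

Lemma syzygy_complement q p a b : q * a - p * b = p * (q - b) - q * (p - a).
Proof. by ring. Qed.

Lemma quotient_error p g w c r :
  p * g = p * g - (p * w - c) - (c - p * w - r) - r.
Proof. by ring. Qed.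

Lemma quotient_error_complement p w f c :
  p * (w - f) - (p * w - f * c) = - (f * (p - c)).
Proof. by ring. Qed.

End SyzygyIdentities.

Section CohenMacaulaySquare.
Variables (k : fieldType) (n : nat) (e : rel 'I_n).
Local Notation S := {mpoly k[n]}.
Local Notation J := (@second_symbolic_power k n e).
Variable s : seq S.
Hypothesis e_irr : irreflexive e.
Hypothesis s_reg : quotient_regular_seq J s.
Hypothesis s_max : forall f, f \in s -> var_ideal [set: 'I_n] f.
Let d := size s.
Let x (i : 'I_d) : S := s`_i.
Local Notation "P '^x'" := ((map_mpoly (@mpolyC n k) P).@[x]) (at level 2).
Implicit Types (m u : 'X_{1..n}) (F H : {set 'I_n}) (f g p w : S).

Let J_ideal : is_ideal J := symbolic_sq_ideal k e.

Let J_sep g : (forall N, power_add d J s d N g) -> J g.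
Proof. exact: symbolic_sq_separated. Qed.

(** Otherwise P(s)^2 would annihilate modulo J the product of the x_i^2, i in F: at F because of
    P(s)^2, and at any other F' because some i in F is outside F'. This product is not in P_F^2,
    which contradicts torsion-freeness. *)
Lemma regular_eval_notin_var (P : {mpoly k[d]}) F : P != 0 ->
  maxset (independent e) F -> ~ supp_in (degin_ge 1 (~: F)) P^x.
Proof.
move=> P0 maxF HP; pose v : 'X_{1..n} := [multinom ((i \in F) * 2)%N | i < n].
have /symbolic_sqP/(_ F maxF)/(_ v) : J 'X_[v].
  apply: (regular_torsion_free J_ideal s_reg J_sep P0).
  apply: (regular_torsion_free J_ideal s_reg J_sep P0).
  apply/symbolic_sqP => F' maxF'; case: (eqVneq F' F) => [->|ne].
    rewrite mulrA; apply: (is_idealMr _ (degin_ge_ideal k 2 (~: F))).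
    by apply: (supp_inM _ HP HP) => m u; rewrite /degin_ge deginD; apply: (@leq_add 1 1).
  have [_ _ IM] := degin_ge_ideal k 2 (~: F'); apply: (IM); apply: (IM); apply: supp_inX.
  have [i iF iF'] : exists2 i, i \in F & i \notin F'.
    apply/subsetPn; apply: contra ne => sub.
    by case/maxsetP: maxF => _ /(_ F' _ sub) ->; rewrite // (maxsetp maxF').
  rewrite /degin_ge /degin (bigD1 i) ?inE //=.
  by rewrite mnmE iF mul1n leq_addr.
rewrite msuppX inE eqxx => /(_ isT); rewrite /degin_ge /degin big1 // => i.
by rewrite inE mnmE => /negPf ->.
Qed.

(** If F had fewer than d elements, the s_i would be algebraically dependent modulo P_F. *)
Lemma regular_max_independent F : maxset (independent e) F -> (d <= #|F|)%N.
Proof.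
move=> maxF; rewrite leqNgt; apply/negP => Fd.
have [P [P0 _ PH]] := alg_dependent_all x [set: 'I_d].
apply: (regular_eval_notin_var P0 maxF).
by apply: PH; rewrite cardsT card_ord.
Qed.

(* If the conclusion fails, multiplication of x_a x_b by the B-components h Q(s)
   of the elements Q(s) of A + B, where A and B are the intersections of the P_F
   with F containing a, resp. b, is a homomorphism to S/J which by (S_2) would
   have to be multiplication by some w congruent to x_a x_b modulo P_F^2 for
   a in F, and to 0 for b in F. *)
Lemma regular_edge_link a b : e a b -> e b a -> exists H,
  [/\ independent e (a |: H), independent e (b |: H) & (d <= #|H|.+1)%N].
Proof.
move=> eab eba; apply: NNPP => Hno.
have Hlt H : independent e (a |: H) -> independent e (b |: H) -> (#|H|.+1 < d)%N.
  by move=> Ha Hb; rewrite ltnNge; apply/negP => le; apply: Hno; exists H.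
have ind1 c : independent e (c |: set0).
  apply/forall_inP => i; rewrite setU0 inE => /eqP ->.
  by apply/forall_inP => j; rewrite inE => /eqP ->; rewrite e_irr.
have d1 : (1 < d)%N by have := Hlt set0 (ind1 a) (ind1 b); rewrite cards0.
have [Fa maxFa aFa] := maxset_exists (ind1 a).
have [Fb maxFb bFb] := maxset_exists (ind1 b).
rewrite setU0 sub1set in aFa; rewrite setU0 sub1set in bFb.
have notboth F : maxset (independent e) F -> a \in F -> b \notin F.
  move=> /maxsetp /forall_inP HF /HF /forall_inP HFa; apply: contraTN eab => /HFa.
  by [].
(* Q_i involves only the d - 1 variables other than T_i, and no monomial of Q_i(s) has a support of
   fewer than d - 1 elements. *)
have /fin_all_exists[Q HQ] (i : 'I_d) := alg_dependent_all x [set~ i].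
have cardD (i : 'I_d) : #|[set~ i]| = d.-1 by rewrite cardsC1 card_ord.
have Q0 i : Q i != 0 by case: (HQ i).
have Qvar i (m : 'X_{1..d}) : m \in msupp (Q i) -> m i = 0%N.
  by case: (HQ i) => _ Hv _ mQ; apply: Hv mQ _ _; rewrite !inE eqxx.
pose i0 : 'I_d := Ordinal (ltnW d1); pose P := Q i0.
(* These are the monomials outside A, so g - h g lies in A for every g. *)
pose notA m := [exists F, [&& maxset (independent e) F, a \in F & degin (~: F) m == 0%N]].
pose h g := msel notA g.
have hA F g : maxset (independent e) F -> a \in F -> supp_in (degin_ge 1 (~: F)) (g - h g).
  move=> maxF aF; apply/supp_inP => m; rewrite /degin_ge -leqNgt leqn0 => m0.
  rewrite mcoeffB mcoeff_msel (_ : notA m) ?subrr //.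
  by apply/existsP; exists F; rewrite maxF aF.
(* The support of a monomial violating this could be completed both by a and by b, so it would have
   fewer than d - 1 elements and could not occur in Q_i(s). *)
have hB F i : maxset (independent e) F -> b \in F ->
    supp_in (degin_ge 1 (~: F)) (h (Q i)^x).
  move=> maxF bF; apply/supp_inP => m; rewrite /degin_ge -leqNgt leqn0 => m0.
  rewrite mcoeff_msel; case: ifP => // /existsP[F' /and3P[maxF' aF' m0']].
  pose H := [set j | m j != 0%N].
  have HF G : degin (~: G) m == 0%N -> H \subset G.
    rewrite degin_eq0 => /forall_inP HG; apply/subsetP => j; rewrite inE.
    by apply: contraR => jG; apply: HG; rewrite inE.
  have lt : (#|H|.+1 < d)%N.
    apply: Hlt; [apply: independent_sub (maxsetp maxF')|apply: independent_sub (maxsetp maxF)].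
      by rewrite subUset sub1set aF' HF.
    by rewrite subUset sub1set bF HF.
  have ltH : (#|H| < #|[set~ i]|)%N by rewrite cardD -subn1 ltn_subRL add1n.
  case: (HQ i) => _ _ /(_ H ltH)/supp_inP/(_ m); apply.
  rewrite /degin_ge -leqNgt leqn0 degin_eq0; apply/forall_inP => j.
  by rewrite !inE negbK.
pose f : S := 'X_[U_(a) + U_(b)].
have fdeg F : degin (~: F) (U_(a) + U_(b))%MM = ((a \notin F) + (b \notin F))%N.
  by rewrite deginD !deginU !inE.
have f2 F : a \notin F -> b \notin F -> supp_in (degin_ge 2 (~: F)) f.
  by move=> aF bF; apply: supp_inX; rewrite /degin_ge fdeg aF bF.
have f1 F : maxset (independent e) F -> supp_in (degin_ge 1 (~: F)) f.
  move=> maxF; apply: supp_inX; rewrite /degin_ge fdeg.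
  by case: (boolP (a \in F)) => // /(notboth F maxF) ->.
have f1M F g : maxset (independent e) F -> supp_in (degin_ge 1 (~: F)) g ->
    supp_in (degin_ge 2 (~: F)) (f * g).
  move=> maxF Hg; apply: (supp_inM _ (f1 F maxF) Hg) => m u.
  by rewrite /degin_ge deginD; apply: (@leq_add 1 1).
(* At F containing a, h is the identity modulo P_F; at F containing b, both values of h vanish
   modulo P_F; in these cases f supplies the second factor. At the remaining F, f itself is in
   P_F^2. *)
have syz i : J ((Q i)^x * (f * h P^x) - P^x * (f * h (Q i)^x)).
  rewrite syzygy_factor.
  apply/symbolic_sqP => F maxF; have I1 := degin_ge_ideal k 1 (~: F).
  have [_ _ IM] := I1; case: (boolP (a \in F)) => aF.
    apply: f1M => //.
    rewrite syzygy_complement.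
    by apply: (is_idealB I1); apply: IM; apply: hA.
  case: (boolP (b \in F)) => bF.
    by apply: f1M => //; apply: (is_idealB I1); apply: IM; apply: hB.
  by apply: (is_idealMr _ (degin_ge_ideal k 2 (~: F))); exact: f2.
have notP F : maxset (independent e) F -> ~ var_ideal (~: F) P^x.
  by move=> maxF /var_idealP; apply: (regular_eval_notin_var (Q0 i0) maxF).
have [Na HNa] := var_ideal_sq_primary (notP Fa maxFa).
have [Nb HNb] := var_ideal_sq_primary (notP Fb maxFb).
pose N := maxn Na Nb.
have [w Ww] := regular_division J_ideal s_reg J_sep (Q0 i0) Q0 Qvar syz N.
have [r Jr Hr] := power_add_max s_max (erefl d) Ww.
have key F g : maxset (independent e) F ->
    supp_in (degin_ge 2 (~: F)) (P^x * g - (P^x * w - f * h P^x)) ->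
    supp_in (fun m => degin_ge 2 (~: F) m || (N <= mdeg m)%N) (P^x * g).
  move=> maxF Hg; move/symbolic_sqP/(_ F maxF): Jr => JF.
  rewrite (quotient_error _ g w (f * h P^x) r).
  apply: supp_inB; last by apply: supp_in_sub Hr => m ->; rewrite orbT.
  by apply: supp_inB; [apply: supp_in_sub Hg|apply: supp_in_sub JF] => m Hm; apply/orP; left.
have mdegab : mdeg (U_(a) + U_(b))%MM = 2%N by rewrite mdegD !mdeg1.
(* The quotient w has coefficient 0 at x_a x_b when viewed at F_b, but coefficient 1 when viewed at
   F_a. *)
have wb : w@_(U_(a) + U_(b)) = 0.
  apply: (HNb N (leq_maxr _ _)) => //; last first.
    by rewrite fdeg bFb addn0 (contraTN (notboth Fb maxFb)).
  apply: key => //; rewrite opprB addrC subrK; apply: f1M => //; exact: hB.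
have wa : (w - f)@_(U_(a) + U_(b)) = 0.
  apply: (HNa N (leq_maxl _ _)) => //; last by rewrite fdeg aFa (notboth Fa).
  apply: key => //.
  rewrite quotient_error_complement.
  by apply: (is_idealN (degin_ge_ideal k 2 (~: Fa))); apply: f1M => //; apply: hA.
move/eqP: wa; rewrite mcoeffB wb mcoeffX eqxx sub0r oppr_eq0.
exact/negP/oner_neq0.
Qed.

End CohenMacaulaySquare.

(** * Bipartite graphs *)

(** Here a, b, ab, i are the sizes of A, B, their union and intersection; x, y are those of N(u +
    A), N(u + B), with union p and intersection q, and ni is that of N(A cap B). *)
Lemma submodular_arith (ab p i ni q x y a b : nat) :
  (ab < p -> i <= ni -> p + q = x + y -> ab + i = a + b -> ni.+2 <= q ->
   x <= a.+1 -> y <= b.+1 -> False)%N.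
Proof. by lia. Qed.

Section BipartiteMatching.
Variables (n : nat) (e : rel 'I_n) (e_sym : symmetric e).
Implicit Types (A B H F X Y : {set 'I_n}) (u v w : 'I_n).

Definition neighbours A := [set y | [exists x in A, e x y]].

Lemma neighboursP A y : reflect (exists2 x, x \in A & e x y) (y \in neighbours A).
Proof. by rewrite inE; apply: exists_inP. Qed.

Lemma neighboursU A B : neighbours (A :|: B) = neighbours A :|: neighbours B.
Proof.
apply/setP => y; rewrite in_setU; apply/neighboursP/orP => [[x]|].
  by rewrite in_setU => /orP[] xA exy; [left|right]; apply/neighboursP; exists x.
by case=> /neighboursP[x xA exy]; exists x; rewrite // in_setU xA ?orbT.
Qed.

Lemma neighboursS A B : A \subset B -> neighbours A \subset neighbours B.
Proof. by move=> /setUidPr <-; rewrite neighboursU subsetUl. Qed.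

Lemma independentP F :
  reflect (forall i j, i \in F -> j \in F -> ~~ e i j) (independent e F).
Proof.
apply: (iffP forall_inP) => [H i j iF jF|H i iF].
  by have /forall_inP := H i iF; apply.
by apply/forall_inP => j; apply: H.
Qed.

Variables (X Y : {set 'I_n}) (d : nat).
Hypothesis XY : X :|: Y = [set: 'I_n].
Hypothesis XYd : X :&: Y = set0.
Hypothesis e_XY : forall i j, e i j -> (i \in X /\ j \in Y) \/ (i \in Y /\ j \in X).
Hypothesis card_ind : forall F, independent e F -> (#|F| <= d)%N.
Hypothesis card_Y : (d <= #|Y|)%N.

Lemma bipartite_edgeP i j : i \in X -> e i j -> j \in Y.
Proof.
move=> iX /e_XY[[_ //]|[iY _]].
by have := in_set0 i; rewrite -XYd inE iX iY.
Qed.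

Lemma bipartite_side_independent : independent e Y.
Proof.
apply/independentP => i j iY jY; apply/negP => /e_XY[[iX _]|[_ jX]].
  by have := in_set0 i; rewrite -XYd inE iX iY.
by have := in_set0 j; rewrite -XYd inE jX jY.
Qed.

Lemma neighbours_sub A : A \subset X -> neighbours A \subset Y.
Proof.
move=> /subsetP AX; apply/subsetP => y /neighboursP[x /AX xX exy].
exact: bipartite_edgeP exy.
Qed.

Lemma bipartite_independent A B : A \subset X -> B \subset Y ->
  [disjoint neighbours A & B] -> independent e (A :|: B).
Proof.
move=> /subsetP AX /subsetP BY dis; apply/independentP => i j.
have nAB i' j' : i' \in A -> j' \in B -> ~~ e i' j'.
  move=> iA jB; apply/negP => eij; have := disjointFl dis jB.
  by move/negbT/neighboursP; apply; exists i'.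
rewrite !in_setU => /orP[iA|iB] /orP[jA|jB].
- apply/negP => /(bipartite_edgeP (AX i iA)) jY.
  by have := in_set0 j; rewrite -XYd inE (AX j jA) jY.
- exact: nAB.
- by rewrite e_sym; apply: nAB.
- by have /independentP := bipartite_side_independent; apply; apply: BY.
Qed.

Lemma bipartite_cardU A B : A \subset X -> B \subset Y ->
  #|A :|: B| = (#|A| + #|B|)%N.
Proof.
move=> AX BY; rewrite cardsU (_ : A :&: B = set0) ?cards0 ?subn0 //.
by apply/eqP; rewrite -subset0 -XYd setISS.
Qed.

(** Hall's inequality: A together with the part of Y outside N(A) is independent, so |A| + |Y| -
    |N(A)| <= d <= |Y|. *)
Lemma neighbours_card A : A \subset X -> (#|A| <= #|neighbours A|)%N.
Proof.
move=> AX; have NY := neighbours_sub AX.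
have BY : Y :\: neighbours A \subset Y by apply: subsetDl.
have := card_ind (bipartite_independent AX BY _).
rewrite bipartite_cardU // cardsD (setIidPr NY) => /(_ _)/leq_trans/(_ card_Y).
have := subset_leq_card NY; set a := #|A|; set b := #|neighbours A|; set c := #|Y|.
move=> bc H; have : (a + (c - b) <= c)%N.
  by apply: H; rewrite -setI_eq0 setIDA setIC -setIDA setDv setI0.
by lia.
Qed.

Hypothesis edge_link : forall a b, e a b -> exists H,
  [/\ independent e (a |: H), independent e (b |: H) & (d <= #|H|.+1)%N].

(* The X-part of H is tight for Hall's condition and stays so when u is added,
   with v the only new neighbour. *)
Lemma edge_link_tight u v : u \in X -> e u v -> exists A,
  [/\ A \subset X, u \notin A, v \notin neighbours A
    & (#|neighbours (u |: A)| <= #|A|.+1)%N].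
Proof.
move=> uX euv; have [H [/independentP Hu /independentP Hv Hd]] := edge_link euv.
have uH : u \notin H.
  apply/negP => uH; have := Hv u v; rewrite !inE eqxx uH orbT euv.
  by move=> /(_ isT isT).
exists (H :&: X); split.
- exact: subsetIr.
- by rewrite inE (negPf uH).
- apply/negP => /neighboursP[x]; rewrite inE => /andP[xH _] exv.
  by have := Hv x v; rewrite !inE eqxx xH orbT exv => /(_ isT isT).
have uA : u |: H :&: X \subset X by rewrite subUset sub1set uX subsetIr.
(* Since |Y| <= d <= |H| + 1, the set Y without H has at most |H cap X| + 1 elements. *)
have sub : neighbours (u |: H :&: X) \subset Y :\: H.
  rewrite subsetD neighbours_sub //=; apply/pred0P => y /=; apply/negP.
  move=> /andP[/neighboursP[x xA exy] yH].
  have := Hu x y; rewrite exy => /(_ _ _)/negP; apply=> //; last by rewrite !inE yH orbT.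
  by move: xA; rewrite !inE => /orP[->//|/andP[-> _]]; rewrite orbT.
have HE : #|H| = (#|H :&: X| + #|H :&: Y|)%N.
  by rewrite -bipartite_cardU ?subsetIr // -setIUr XY setIT.
have c1 := subset_leq_card sub; rewrite cardsD [Y :&: H]setIC in c1.
have c2 := card_ind bipartite_side_independent.
apply: leq_trans c1 _; rewrite leq_subLR addnS addnC -HE.
exact: leq_trans Hd.
Qed.

(** For v different from w, the intersection of N(u + A) and N(u + B) contains N(A cap B) and also v
    and w. With Hall's inequality for u + (A cup B) and A cap B this makes |N(u + A)| + |N(u + B)|
    exceed |A| + |B| + 2. *)
Lemma edge_link_unique u v w : u \in X -> e u v -> e u w -> v = w.
Proof.
move=> uX euv euw; apply/eqP; apply: contraT => vw.
have [A [AX uA vA Acard]] := edge_link_tight uX euv.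
have [B [BX uB wB Bcard]] := edge_link_tight uX euw.
have uAB : u \notin A :|: B by rewrite inE negb_or uA.
have UX : u |: (A :|: B) \subset X by rewrite !subUset sub1set uX AX.
have IX : A :&: B \subset X by apply: subset_trans AX; apply: subsetIl.
have c1 := neighbours_card UX; rewrite cardsU1 uAB in c1.
have c2 := neighbours_card IX.
have c3 : (#|neighbours (u |: A) :|: neighbours (u |: B)| +
    #|neighbours (u |: A) :&: neighbours (u |: B)| =
    #|neighbours (u |: A)| + #|neighbours (u |: B)|)%N := cardsUI _ _.
have c4 : (#|A :|: B| + #|A :&: B| = #|A| + #|B|)%N := cardsUI _ _.
have c5 : neighbours (u |: (A :|: B)) = neighbours (u |: A) :|: neighbours (u |: B).
  by rewrite -neighboursU setUACA setUid.
have c6 : (#|neighbours (A :&: B)|.+2 <= #|neighbours (u |: A) :&: neighbours (u |: B)|)%N.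
  have nb y C : e u y -> y \in neighbours (u |: C).
    by move=> euy; apply/neighboursP; exists u; rewrite // setU11.
  have vN : v \notin neighbours (A :&: B).
    by apply: contra vA; apply: subsetP; apply: neighboursS; apply: subsetIl.
  have wN : w \notin neighbours (A :&: B).
    by apply: contra wB; apply: subsetP; apply: neighboursS; apply: subsetIr.
  have <- : #|v |: (w |: neighbours (A :&: B))| = #|neighbours (A :&: B)|.+2.
    by rewrite !cardsU1 wN in_setU1 negb_or vw vN.
  apply: subset_leq_card; rewrite !subUset !sub1set !in_setI !nb //=.
  rewrite subsetI; apply/andP; split; apply: neighboursS.
    by apply: subset_trans (subsetIl A B) _; apply: subsetUr.
  by apply: subset_trans (subsetIr A B) _; apply: subsetUr.
rewrite c5 in c1.
by case: (submodular_arith c1 c2 c3 c4 c6 Acard Bcard).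
Qed.


End BipartiteMatching.

Lemma cohen_macaulay_matching (k : fieldType) (n : nat) (e : rel 'I_n) :
  symmetric e -> irreflexive e -> bipartite e ->
  (forall i : 'I_n, (0 < degree e i)%N) ->
  graded_cohen_macaulay (second_symbolic_power k e) -> disjoint_union_of_edges e.
Proof.
move=> e_sym e_irr [X [Y [XY XYd e_XY]]] no_isolated.
move=> [d [[[s [s_reg s_max size_s]] _] [_ dim_max]]].
have card_ind F : independent e F -> (#|F| <= d)%N.
  by move=> /(independent_chain k)[Q /dim_max].
(* Without isolated vertices each side of the bipartition is a maximal independent set, to which
   unmixedness applies. *)
have side (A B : {set 'I_n}) : A :|: B = [set: 'I_n] -> independent e A ->
    (forall i j, e i j -> (i \in A /\ j \in B) \/ (i \in B /\ j \in A)) ->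
    (d <= #|A|)%N.
  move=> AB indA e_AB; rewrite -size_s; apply: (regular_max_independent s_reg s_max).
  apply/maxsetP; split=> // F indF AF; apply/eqP; rewrite eqEsubset AF andbT.
  apply/subsetP => i iF; apply: contraT => iA.
  have /card_gt0P[j] := no_isolated i; rewrite inE => eij.
  have jA : j \in A by case: (e_AB i j eij) => -[// iA']; rewrite iA' in iA.
  move/independentP: indF => /(_ i j iF).
  by rewrite eij => /(_ (subsetP AF j jA)).
have YX : Y :|: X = [set: 'I_n] by rewrite setUC.
have YXd : Y :&: X = set0 by rewrite setIC.
have e_YX i j : e i j -> (i \in Y /\ j \in X) \/ (i \in X /\ j \in Y).
  by case/e_XY; [right|left].
have link a b : e a b -> exists H,
    [/\ independent e (a |: H), independent e (b |: H) & (d <= #|H|.+1)%N].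
  move=> eab; rewrite -size_s; apply: (regular_edge_link e_irr s_reg s_max eab).
  by rewrite e_sym.
have cardX := side X Y XY (bipartite_side_independent YXd e_YX) e_XY.
have cardY := side Y X YX (bipartite_side_independent XYd e_XY) e_YX.
move=> i; apply/eqP; rewrite eqn_leq no_isolated andbT; apply/card_le1_eqP => v w.
rewrite !inE => eiv eiw; have : i \in X :|: Y by rewrite XY inE.
rewrite inE => /orP[iX|iY].
  exact: (edge_link_unique e_sym XY XYd e_XY card_ind cardY link iX eiw eiv).
exact: (edge_link_unique e_sym YX YXd e_YX card_ind cardX link iY eiw eiv).
Qed.

(** * Disjoint unions of edges *)

Section Binomial.
Variables (k : fieldType) (n : nat) (x y : 'I_n).
Implicit Types (m : 'X_{1..n}) (f : {mpoly k[n]}).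

Lemma mcoeff_mulU i f m : ('X_i * f)@_m = if m i == 0%N then 0 else f@_(m - U_(i)).
Proof.
case: ifP => mi; last first.
  have le : (U_(i) <= m)%MM by rewrite lep1mP mi.
  by rewrite -{1}(submK le) addmC mulrC mcoeffMX.
apply: memN_msupp_eq0; apply/negP => /msuppM_le /allpairsP[[u v] /= [+ _ E]].
by rewrite msuppX inE => /eqP uE; move: mi; rewrite E uE mnmDE mnm1E eqxx.
Qed.

(* Reading off the coefficients of (x - y) f at m + y: the coefficients of f
   are carried along the diagonal towards smaller powers of x. *)
Lemma binomial_regular (a : pred 'X_{1..n}) f : x != y ->
  (forall m, a m -> (m x <= m y)%N -> a (m + U_(y))%MM) ->
  (forall m, a m -> (m x <= m y)%N -> m x != 0%N -> a (m - U_(x) + U_(y))%MM) ->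
  (forall m, a m -> (('X_x - 'X_y) * f)@_m = 0) ->
  forall m, a m -> (m x <= m y)%N -> f@_m = 0.
Proof.
move=> xy aD aS H m; move: {2}(m x) (erefl (m x)) => c.
have neq : ((x == y) = false) * ((y == x) = false) by rewrite [y == x]eq_sym (negPf xy).
elim: c m => [|c IH] m mc am le; have := H _ (aD m am le).
all: rewrite mulrBl mcoeffB !mcoeff_mulU !mnmDE !mnm1E eqxx !neq addn1 addn0 mc /=.
all: rewrite addmK.
  by rewrite sub0r => /eqP; rewrite oppr_eq0 => /eqP.
have le1 : (U_(x) <= m)%MM by rewrite lep1mP mc.
have -> : (m + U_(y) - U_(x) = m - U_(x) + U_(y))%MM.
  by apply/mnmP => i; rewrite !(mnmDE, mnmBE); have /mnm_lepP/(_ i) := le1; lia.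
rewrite IH ?sub0r; first by move=> /eqP; rewrite oppr_eq0 => /eqP.
- by rewrite mnmDE mnmBE !mnm1E eqxx !neq mc; lia.
- by apply: aS => //; rewrite mc.
by rewrite !mnmDE !mnmBE !mnm1E !eqxx !neq mc; lia.
Qed.

End Binomial.

Section PerfectMatching.
Variables (k : fieldType) (n : nat) (e : rel 'I_n).
Variables (sigma : 'I_n -> 'I_n) (X : {set 'I_n}).
Hypothesis sigmaK : involutive sigma.
Hypothesis e_sigma : forall i j, e i j = (j == sigma i).
Hypothesis sigma_X : forall i, (sigma i \in X) = (i \notin X).
Local Notation S := {mpoly k[n]}.
Local Notation J := (@second_symbolic_power k n e).
Implicit Types (m u : 'X_{1..n}) (F : {set 'I_n}) (l : seq 'I_n) (f g : S).

Lemma sum_matching (g : 'I_n -> nat) :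
  (\sum_j g j = \sum_(x in X) (g x + g (sigma x)))%N.
Proof.
rewrite big_split /= (bigID (mem X)) /=; congr (_ + _)%N.
rewrite (reindex_inj (inv_inj sigmaK)) /=.
by apply: eq_bigl => j; rewrite sigma_X negbK.
Qed.

Lemma matching_independentP F :
  reflect (forall i, i \in F -> sigma i \notin F) (independent e F).
Proof.
apply: (iffP (independentP e F)) => [H i iF|H i j iF jF].
  by apply/negP => /(H i _ iF); rewrite e_sigma eqxx.
by rewrite e_sigma; apply: contraL jF => /eqP ->; apply: H.
Qed.

Lemma matching_side_independent : independent e X.
Proof. by apply/matching_independentP => i; rewrite sigma_X negbK. Qed.

(** Sending each vertex to the X-end of its edge is injective on an independent set. *)
Lemma matching_card_independent F : independent e F -> (#|F| <= #|X|)%N.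
Proof.
move=> /matching_independentP HF; pose r i := if i \in X then i else sigma i.
have rX i : r i \in X by rewrite /r; case: ifP => // iX; rewrite sigma_X iX.
rewrite -(card_in_imset (f := r)); last first.
  move=> i j iF jF; rewrite /r; case: ifP => iX; case: ifP => jX //.
  - by move=> E; have := HF j jF; rewrite -E iF.
  - by move=> E; have := HF i iF; rewrite E jF.
  - exact: inv_inj.
by apply: subset_leq_card; apply/subsetP => _ /imsetP[i _ ->].
Qed.

(* The order of a monomial with respect to the ideal generated by the
   x_i x_(sigma i), after identifying x_i with x_(sigma i) for i in l. *)
Definition matching_order l m := (\sum_(x in X)
  (if x \in l then (m x + m (sigma x))./2 else minn (m x) (m (sigma x))))%N.

(** The least degree outside F, over all maximal independent F, is attained by keeping in F the end
    with the larger exponent on each edge; ties go to X. What remains is the sum of the minima. *)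
Lemma matching_symbolic_sqP f :
  J f <-> supp_in (fun m => 2 <= matching_order [::] m)%N f.
Proof.
split=> [/symbolic_sqP Hf m mf|Hf].
  pose F := [set j | (m (sigma j) < m j)%N || ((m (sigma j) == m j) && (j \in X))].
  have indF : independent e F.
    apply/matching_independentP => i; rewrite !inE sigmaK sigma_X.
    by case: ltngtP => //= _ ->.
  have maxF : maxset (independent e) F.
    apply/maxsetP; split=> // F' /matching_independentP indF' sub.
    apply/eqP; rewrite eqEsubset sub andbT; apply/subsetP => i iF'.
    apply: contraT => iF; have := indF' i iF'; rewrite (subsetP sub) //.
    by move: iF; rewrite !inE sigmaK sigma_X; case: ltngtP => //= _ ->.
  apply: leq_trans (Hf F maxF m mf) _.
  rewrite /degin big_mkcond sum_matching; apply: leq_sum => x xX.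
  by rewrite !inE sigmaK sigma_X xX; case: ltngtP => //=; lia.
apply/symbolic_sqP => F /maxsetp/matching_independentP indF m /Hf Hm.
apply: leq_trans Hm _; rewrite /degin [X in (_ <= X)%N]big_mkcond sum_matching.
apply: leq_sum => x xX; rewrite !inE.
case: (boolP (x \in F)) => [/indF -> /=|_ /=]; first by rewrite geq_minr.
by rewrite (leq_trans (geq_minl _ _)) ?leq_addr.
Qed.

(** * Quotients by some of the forms x_i - x_(sigma i) *)

Section Identification.
Variable l : seq 'I_n.
Hypothesis lX : {subset l <= X}.

Let rep i := if sigma i \in l then sigma i else i.
Let psi : S -> S := mmap (@mpolyC n k) (fun i => 'X_(rep i)).
Let linear_forms := [seq 'X_x - 'X_(sigma x) : S | x <- l].
Let Jl := ideal_add_seq J linear_forms.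

Lemma repX x : x \in X -> rep x = x.
Proof.
rewrite /rep => xX; case: ifP => // /lX; by rewrite sigma_X xX.
Qed.

Lemma rep_sigma x : rep (sigma x) = if x \in l then x else sigma x.
Proof. by rewrite /rep sigmaK. Qed.

Definition mrep m : 'X_{1..n} := [multinom
  (if j \in X then m j + (if j \in l then m (sigma j) else 0)
   else if sigma j \in l then 0 else m j)%N | j < n].

Lemma psiX m : psi 'X_[m] = 'X_[mrep m].
Proof.
rewrite /psi mmapX /mmap1.
rewrite (eq_bigr (fun i => 'X_[U_(rep i) *+ m i])); last by move=> i _; rewrite mpolyXn.
rewrite -(big_morph _ (@mpolyXD _ _) (@mpolyX0 _ _)); congr 'X_[_].
apply/mnmP => j; rewrite mnm_sumE mnmE sum_matching.
have E x : x \in X -> ((U_(rep x) *+ m x)%MM j + (U_(rep (sigma x)) *+ m (sigma x))%MM j =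
    (if x == j then m j else 0) + (if rep (sigma x) == j then m (sigma x) else 0))%N.
  move=> xX; rewrite !mulmnE !mnm1E repX //; congr (_ + _)%N.
    by case: eqP => [->|]; rewrite ?mul1n ?mul0n.
  by case: eqP; rewrite ?mul1n ?mul0n.
rewrite (eq_bigr _ E) big_split /=; case: ifP => jX.
  congr (_ + _)%N.
    rewrite (bigD1 j) //= eqxx big1 ?addn0 // => i /andP[_ /negPf ->] //.
  rewrite (bigD1 j) //= rep_sigma big1 ?addn0.
    case: (j \in l); rewrite ?eqxx //.
    by case: eqP => // E'; have := sigma_X j; rewrite E' jX.
  move=> i /andP[iX /negPf ij]; rewrite rep_sigma; case: (i \in l); rewrite ?ij //.
  by case: eqP => // E'; have := sigma_X i; rewrite E' iX jX.
rewrite big1 ?add0n; last by move=> i iX; case: eqP => // E'; rewrite E' jX in iX.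
have sjX : sigma j \in X by rewrite sigma_X jX.
rewrite (bigD1 (sigma j)) //= rep_sigma big1 ?addn0.
  case: (sigma j \in l); last by rewrite sigmaK eqxx.
  by case: eqP => // E'; rewrite E' jX in sjX.
move=> i /andP[iX ij]; rewrite rep_sigma; case: (i \in l).
  by case: eqP => // E'; rewrite E' jX in iX.
by case: eqP => // E'; rewrite -E' sigmaK eqxx in ij.
Qed.

Lemma psiM : {morph psi : f g / f * g}.
Proof. exact: rmorphM. Qed.

Lemma psiB : {morph psi : f g / f - g}.
Proof. exact: raddfB. Qed.

Lemma psi1 : psi 1 = 1.
Proof. exact: rmorph1. Qed.

Lemma psiXU i : psi 'X_i = 'X_(rep i).
Proof. by rewrite /psi mmapX mmap1U. Qed.

Lemma psiE f : psi f = \sum_(m <- msupp f) f@_m *: psi 'X_[m].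
Proof. by apply: eq_bigr => m _; rewrite /psi mmapX mul_mpolyC. Qed.

Lemma matching_order_mrep m : (matching_order [::] m <= matching_order l (mrep m))%N.
Proof.
apply: leq_sum => x xX; rewrite !mnmE sigma_X sigmaK xX /=.
by case: (x \in l); lia.
Qed.

Lemma sub_psi_mem f : Jl (f - psi f).
Proof.
have Jl_ideal : is_ideal Jl by apply: ideal_add_seq_ideal.
have [_ JD JM] := Jl_ideal.
have closedM p q : Jl (p - psi p) -> Jl (q - psi q) -> Jl (p * q - psi (p * q)).
  move=> Hp Hq; rewrite psiM.
  have -> : p * q - psi p * psi q = p * (q - psi q) + psi q * (p - psi p).
    by move: (psi p) (psi q) => p' q'; ring.
  by apply: JD; apply: JM.
have closedX m : Jl ('X_[m] - psi 'X_[m]).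
  rewrite mpolyXE_id; elim/big_ind: _ => [|p q|i _]; first by rewrite psi1 subrr; case: Jl_ideal.
    exact: closedM.
  elim: (m i) => [|c IH]; first by rewrite expr0 psi1 subrr; case: Jl_ideal.
  rewrite exprS; apply: closedM IH.
  rewrite psiXU /rep; case: ifP => il; last by rewrite subrr; case: Jl_ideal.
  rewrite -opprB; apply: is_idealN => //; apply: ideal_add_seq_mem.
  by apply/mapP; exists (sigma i) => //; rewrite sigmaK.
rewrite psiE {1}[f]mpolyE -sumrB; apply: ideal_sum => // m _ _.
by rewrite -scalerBr -mul_mpolyC; apply: JM.
Qed.

(** The substitution [psi] is the identity modulo the forms in l and kills these forms, so
    membership is decided after applying it, by a monomial condition. *)
Lemma matching_add_seqP f :
  Jl f <-> supp_in (fun m => 2 <= matching_order l m)%N (psi f).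
Proof.
have Jl_ideal : is_ideal Jl by apply: ideal_add_seq_ideal.
have order_ideal : is_ideal (@supp_in k n (fun m => 2 <= matching_order l m)%N).
  apply: supp_in_ideal => u m /leq_trans; apply; apply: leq_sum => x _.
  by rewrite !mnmDE; case: ifP => _; lia.
split.
  have pre_ideal : is_ideal (fun f => supp_in (fun m => 2 <= matching_order l m)%N (psi f)).
    have [I0 ID IM] := order_ideal; split.
    - by rewrite [psi 0]raddf0.
    - by move=> a b Ha Hb; rewrite [psi _]raddfD; apply: ID.
    - by move=> a b Hb; rewrite psiM; apply: IM.
  apply: (ideal_gen_min pre_ideal) => g [/matching_symbolic_sqP Jg|/mapP[x xl ->]].
    rewrite psiE; apply: supp_in_sum => m mg _; rewrite psiX; apply: supp_inZX.
    exact: leq_trans (Jg m mg) (matching_order_mrep m).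
  rewrite psiB !psiXU rep_sigma xl repX ?lX // subrr; exact: supp_in0.
move=> Hf; rewrite -(subrK (psi f) f).
have [_ JD _] := Jl_ideal; apply: (JD); first exact: sub_psi_mem.
apply: monomial_ideal_sub Hf => // m Hm.
(* On each edge in l the total exponent is split as evenly as possible. This leaves the image under
   [psi] unchanged and makes the minimum equal to the halved sum, so that m' lies in J. *)
pose m' : 'X_{1..n} := [multinom (if j \in X then
    (if j \in l then uphalf (m j + m (sigma j)) else m j)
  else if sigma j \in l then (m j + m (sigma j))./2 else m j)%N | j < n].
have mrepE : mrep m' = mrep m.
  apply/mnmP => j; rewrite !mnmE sigma_X sigmaK.
  case: (boolP (j \in X)) => jX /=; last by case: (sigma j \in l).
  by case: (j \in l) => //; lia.
have Jm' : Jl 'X_[m'].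
  apply: ideal_add_seqW; apply/matching_symbolic_sqP; apply: supp_inX.
  apply: leq_trans Hm _; apply: leq_sum => x xX; rewrite !mnmE sigma_X sigmaK xX /=.
  by case: (x \in l) => //; lia.
have -> : 'X_[m] = ('X_[m] - psi 'X_[m]) - ('X_[m'] - psi 'X_[m']) + 'X_[m'] :> S.
  by rewrite !psiX mrepE opprB addrA !subrK.
by apply: JD => //; apply: is_idealB => //; apply: sub_psi_mem.
Qed.

(** On this edge the order depends only on the smaller exponent. Carrying coefficients towards a
    smaller minimum therefore stays outside the monomial ideal, and the two cases differ by which
    end has the smaller exponent. *)
Lemma matching_regular_step x f : x \in X -> x \notin l ->
  Jl (('X_x - 'X_(sigma x)) * f) -> Jl f.
Proof.
move=> xX xl /matching_add_seqP; rewrite psiM psiB !psiXU rep_sigma (negPf xl).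
rewrite repX // => /supp_inP H.
apply/matching_add_seqP/supp_inP => m; rewrite -ltnNge => am.
have x_sx : x != sigma x by apply/eqP => E; have := sigma_X x; rewrite -E xX.
have order_le (u v : 'X_{1..n}) : (minn (u x) (u (sigma x)) <= minn (v x) (v (sigma x)))%N ->
    (forall i, i != x -> i != sigma x -> u i = v i) ->
    (matching_order l v < 2 -> matching_order l u < 2)%N.
  move=> le_x uv; apply: leq_ltn_trans; rewrite /matching_order.
  rewrite (bigD1 x) // [X in (_ <= X)%N](bigD1 x) //= (negPf xl) leq_add //.
  apply: leq_sum => i /andP[iX ix]; rewrite !uv //.
  - by rewrite (inv_eq sigmaK); apply: contraTneq iX => ->; rewrite sigma_X xX.
  - by rewrite (inj_eq (inv_inj sigmaK)).
  - by apply: contraTneq iX => ->; rewrite sigma_X xX.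
have neq : ((x == sigma x) = false) * ((sigma x == x) = false).
  by rewrite [sigma x == x]eq_sym (negPf x_sx).
have a0 (u : 'X_{1..n}) : (matching_order l u < 2)%N -> (('X_x - 'X_(sigma x)) * psi f)@_u = 0.
  by move=> au; apply: H; rewrite -ltnNge.
have [le|ge] := leqP (m x) (m (sigma x)).
  apply: (binomial_regular (a := fun u => (matching_order l u < 2)%N) x_sx) le => //.
  - move=> u au le; apply: order_le au => [|i ix isx].
      by rewrite !mnmDE !mnm1E eqxx !neq; lia.
    by rewrite mnmDE mnm1E eq_sym (negPf isx) addn0.
  - move=> u au le ux; apply: order_le au => [|i ix isx].
      by rewrite !mnmDE !mnmBE !mnm1E !eqxx !neq; lia.
    by rewrite mnmDE mnmBE !mnm1E ![_ == i]eq_sym (negPf isx) (negPf ix) subn0 addn0.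
have sx_x : sigma x != x by rewrite eq_sym.
apply: (binomial_regular (a := fun u => (matching_order l u < 2)%N) sx_x) (ltnW ge) => //.
- move=> u au le; apply: order_le au => [|i ix isx].
    by rewrite !mnmDE !mnm1E eqxx !neq; lia.
  by rewrite mnmDE mnm1E eq_sym (negPf ix) addn0.
- move=> u au le ux; apply: order_le au => [|i ix isx].
    by rewrite !mnmDE !mnmBE !mnm1E !eqxx !neq; lia.
  by rewrite mnmDE mnmBE !mnm1E ![_ == i]eq_sym (negPf isx) (negPf ix) subn0 addn0.
by move=> u au; rewrite -opprB mulNr mcoeffN a0 // oppr0.
Qed.


End Identification.

Lemma matching_cohen_macaulay : graded_cohen_macaulay J.
Proof.
pose s : seq S := [seq 'X_x - 'X_(sigma x) | x <- enum X].
have maxF F : maxset (independent e) F -> (#|F| <= #|X|)%N.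
  by move=> /maxsetp; apply: matching_card_independent.
have take_sub i : {subset take i (enum X) <= X}.
  by move=> x /mem_take; rewrite mem_enum.
exists #|X|; split; split.
(* The forms x_i - x_(sigma i), i in X, attain the depth bound, and the chain of primes starting at
   P_X attains the dimension bound. *)
- exists s; split; last by rewrite size_map -cardE.
    split=> [i|].
      rewrite size_map => iX g; rewrite /s -map_take.
      have [x0 _] : exists x0 : 'I_n, x0 \in X.
        by apply/card_gt0P; rewrite cardE; apply: leq_ltn_trans iX.
      rewrite (nth_map x0) //; apply: matching_regular_step => //.
        by rewrite -mem_enum mem_nth.
      apply/negP => /(nthP x0)[j]; rewrite size_takel; last exact: ltnW.
      move=> ji; rewrite nth_take // => /eqP.
      by rewrite nth_uniq ?enum_uniq ?(ltn_trans ji) // ltn_eqF.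
    have lX : {subset enum X <= X} by move=> x; rewrite mem_enum.
    move=> /(matching_add_seqP lX); rewrite psi1 => /(_ 0%MM).
    rewrite msupp1 inE eqxx => /(_ isT); rewrite /matching_order big1 // => x _.
    by rewrite !mnm0E if_same.
  move=> f /mapP[x _ ->]; apply: is_idealB; first exact: ideal_gen_ideal.
    by apply: ideal_genW; exists x; rewrite ?inE.
  by apply: ideal_genW; exists (sigma x); rewrite ?inE.
- by move=> s' s'_reg _; apply: symbolic_sq_regular_bound s'_reg.
- exact: independent_chain matching_side_independent.
by move=> d' Q; apply: symbolic_sq_chain_bound.
Qed.

End PerfectMatching.

Lemma disjoint_edges_cohen_macaulay (k : fieldType) (n : nat) (e : rel 'I_n) :
  symmetric e -> irreflexive e -> bipartite e -> disjoint_union_of_edges e ->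
  graded_cohen_macaulay (second_symbolic_power k e).
Proof.
move=> e_sym e_irr [X [Y [XY XYd e_XY]]] deg1.
have /fin_all_exists[sigma Hs] i : exists j, [set j | e i j] = [set j].
  by apply/cards1P; rewrite -/(degree e i) deg1.
have e_sigma i j : e i j = (j == sigma i).
  by have /setP/(_ j) := Hs i; rewrite !inE.
have sigmaK : involutive sigma.
  by move=> i; apply/esym/eqP; rewrite -e_sigma e_sym e_sigma.
apply: (matching_cohen_macaulay k sigmaK e_sigma (X := X)) => i.
have Yi : (i \in Y) = (i \notin X).
  have := in_set0 i; rewrite -XYd inE; have := in_setT i; rewrite -XY inE.
  by case: (i \in X); case: (i \in Y).
have := e_XY i (sigma i); rewrite e_sigma eqxx => /(_ isT)[[iX sY]|[iY ->]].
  rewrite iX; apply/negbTE/negP => sX.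
  by have := in_set0 (sigma i); rewrite -XYd inE sX sY.
by rewrite -Yi iY.
Qed.

Theorem proposition4p2 (k : fieldType) (n : nat) (hn : (0 < n)%N)
    (e : rel 'I_n) (e_sym : symmetric e) (e_irr : irreflexive e)
    (e_bip : bipartite e) (no_isolated : forall i : 'I_n, (0 < degree e i)%N) :
  graded_cohen_macaulay (second_symbolic_power k e) <->
  disjoint_union_of_edges e.
Proof.
split; first exact: cohen_macaulay_matching.
exact: disjoint_edges_cohen_macaulay.
Qed.
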